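(* For any signature $\lambda=(\lambda_1\ge\cdots\ge\lambda_N\ge0)$ of size $N$ with nonnegative coordinates and any $q\neq1$ we have $$\mathfrak X_\lambda(x;N,q)=\frac{(-1)^{N-1}\ln(q)\,(q-1)^{2N-1}[2N]_q!}{(xq;q)_{N-1}(x^{-1}q;q)_{N-1}(x-x^{-1})[N]_q}\cdot\frac1{2\pi\mathbf{i}}\oint_C\frac{x^{z+1}-x^{-z-1}}{\prod_{i=1}^N\bigl(q^{z+1}+q^{-z-1}-q^{-\lambda_i-N+i-1}-q^{\lambda_i+N-i+1}\bigr)}\,dz$$ with contour $C$ enclosing the singularities of the integrand at $z=\lambda_1+N-1,\dots,\lambda_N$ (that is, at $z=\lambda_i+N-i$, $i=1,\dots,N$).
   Context: Symplectic characters: for integers $\lambda_1\ge\cdots\ge\lambda_N\ge0$, $$\chi_\lambda(x_1,\dots,x_N)=\frac{\det\bigl[x_i^{\lambda_j+N+1-j}-x_i^{-(\lambda_j+N+1-j)}\bigr]_{i,j=1}^N}{\det\bigl[x_i^{N+1-j}-x_i^{-N-1+j}\bigr]_{i,j=1}^N},$$ and the normalized character of one variable is $\mathfrak X_\lambda(x;N,q)=\chi_\lambda(x,q,\dots,q^{N-1})/\chi_\lambda(q,q^2,\dots,q^N)$. Notation: $[m]_q=\frac{q^m-1}{q-1}$, $[a]_q!=\prod_{m=1}^a[m]_q$, $(a;q)_k=\prod_{i=0}^{k-1}(1-aq^i)$, $\mathbf{i}=\sqrt{-1}$.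
   Formalization: The right-hand side is multiplied by the missing factor q^{-N(N+1)/2}; as printed the identity fails: for N=1, λ=(0) the left side is 1 while the printed right side equals q. *)

(* Defs.v *)
From mathcomp Require Export all_boot all_order all_algebra.
From mathcomp Require Export all_classical all_reals all_analysis.
From mathcomp Require Export complex.
From mathcomp Require Import zify.
Export Order.TTheory GRing.Theory Num.Theory.
Export numFieldNormedType.Exports.

Set Implicit Arguments.
Unset Strict Implicit.
Unset Printing Implicit Defensive.

Local Open Scope ring_scope.
Local Open Scope complex_scope.
Local Open Scope classical_set_scope.

Section qAnalogues.
Variable F : fieldType.
Implicit Types (a q : F).

Definition qnum q (m : nat) : F := (q ^+ m - 1) / (q - 1).

Definition qfact q (a : nat) : F := \prod_(1 <= m < a.+1) qnum q m.

Definition qpoch a q (k : nat) : F := \prod_(i < k) (1 - a * q ^+ i).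

End qAnalogues.

Section SymplecticCharacter.
Variables (F : fieldType) (N : nat).

(* Indices are 0-based: [tnth lam j] is lambda_{j+1}, so this is the exponent
   lambda_{j+1} + N + 1 - (j+1), always positive. *)
Definition shifted_part (lam : N.-tuple nat) (j : 'I_N) : nat :=
  (tnth lam j + (N - j))%N.

Definition symp_char (lam : N.-tuple nat) (x : 'I_N -> F) : F :=
  \det (\matrix_(i < N, j < N)
          (x i ^+ shifted_part lam j - x i ^- shifted_part lam j))
  / \det (\matrix_(i < N, j < N) (x i ^+ (N - j) - x i ^- (N - j))).

Definition symp_char_principal (lam : N.-tuple nat) (q : F) : F :=
  symp_char lam (fun i => q ^+ i.+1).

Definition norm_symp_char (lam : N.-tuple nat) (x q : F) : F :=
  symp_char lam (fun i => if i == 0%N :> nat then x else q ^+ i)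
  / symp_char_principal lam q.

End SymplecticCharacter.

Section NonVanishing.
Variables (F : fieldType) (N : nat).

Lemma det_odd_powers_neq0 (y : 'I_N -> F) :
  injective y -> (forall j, y j != 0) -> (forall j, y j != 1) ->
  (forall j k, y j * y k != 1) ->
  \det (\matrix_(i < N, j < N) (y j ^+ i.+1 - y j ^- i.+1)) != 0.
Proof.
move=> yI y0 y1 yy; apply/negP => /det0P[v v0 /rowP vM].
pose P : {poly F} := \sum_(i < N) v 0 i *: ('X^(N + i.+1) - 'X^(N - i.+1)).
have Pev z : z != 0 ->
    P.[z] = z ^+ N * \sum_(i < N) v 0 i * (z ^+ i.+1 - z ^- i.+1).
  move=> z0; rewrite horner_sum mulr_sumr; apply: eq_bigr => i _.
  rewrite hornerZ hornerD hornerN !hornerXn mulrCA; congr (_ * _).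
  by rewrite mulrBr exprD -expfB_cond // (negPf z0) add0n.
have Py j : P.[y j] = 0.
  rewrite Pev //; have := vM j; rewrite !mxE => E.
  suff -> : \sum_(i < N) v 0 i * (y j ^+ i.+1 - y j ^- i.+1) = 0 by rewrite mulr0.
  by rewrite -[RHS]E; apply: eq_bigr => i _; rewrite mxE.
have PyV j : P.[(y j)^-1] = 0.
  rewrite Pev ?invr_eq0 //; have := Py j; rewrite Pev // => /eqP.
  rewrite mulf_eq0 expf_eq0 (negPf (y0 j)) andbF /= => /eqP E.
  suff -> : \sum_(i < N) v 0 i * ((y j)^-1 ^+ i.+1 - (y j)^-1 ^- i.+1) = 0.
    by rewrite mulr0.
  apply: etrans (etrans (congr1 -%R E) (oppr0 _)); rewrite -sumrN.
  by apply: eq_bigr => i _; rewrite !exprVn invrK -mulrN opprB.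
have P1 : P.[1] = 0.
  rewrite Pev ?oner_neq0 // big1 ?mulr0 // => i _.
  by rewrite !expr1n invr1 subrr mulr0.
pose s := 1 :: ([seq y j | j <- enum 'I_N] ++ [seq (y j)^-1 | j <- enum 'I_N]).
have sP : all (root P) s.
  rewrite /s /= rootE P1 eqxx all_cat !all_map /=.
  by apply/andP; split; apply/allP => j _ /=; rewrite rootE ?Py ?PyV.
have us : uniq s.
  rewrite /s /= cat_uniq mem_cat negb_or !map_inj_uniq ?enum_uniq //=; last first.
    by move=> j k /invr_inj /yI.
  rewrite ?andbT -?andbA; apply/and3P; split.
  - by apply/mapP => -[j _ /eqP]; rewrite eq_sym (negPf (y1 j)).
  - apply/mapP => -[j _ /eqP]; rewrite eq_sym invr_eq1; exact/negP.
  - rewrite -enumT enum_uniq andbT /=; apply/hasPn => _ /mapP[j _ ->]; apply/mapP => -[k _ /eqP].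
    rewrite eq_sym -(inj_eq (mulIf (y0 j))) mulVf //; exact/negP.
have sz : (size P <= N.*2.+1)%N.
  apply: leq_trans (size_sum _ _ _) _; apply/bigmax_leqP => i _.
  apply: leq_trans (size_scale_leq _ _) _.
  apply: leq_trans (size_polyD _ _) _.
  rewrite size_polyN !size_polyXn geq_max -addnn; have := ltn_ord i.
  by move: (val i) => k; lia.
have Pz : P = 0.
  apply/eqP/contraT => P0; have := max_poly_roots P0 sP us.
  rewrite /s /= size_cat !size_map -?enumT size_enum_ord addnn => lt.
  by have := leq_trans lt sz; rewrite ltnn.
case/negP: v0; apply/eqP/rowP => i; rewrite mxE.
have := coef0 F (N + i.+1); rewrite -Pz coef_sum (bigD1 i) //= big1 ?addr0.
  rewrite coefZ coefB !coefXn eqxx; set b := (_ == _).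
  have -> : b = false by apply/eqP; have := ltn_ord i; move: (val i) => k; lia.
  by rewrite subr0 mulr1.
move=> k ki; rewrite coefZ coefB !coefXn.
have -> : (N + i.+1 == N + k.+1)%N = false.
  by apply/eqP => /addnI [] /val_inj ik; rewrite ik eqxx in ki.
have -> : (N + i.+1 == N - k.+1)%N = false by apply/eqP; lia.
by rewrite subr0 mulr0.
Qed.

Lemma expf_inj (q : F) : q != 0 ->
  (forall m, (0 < m)%N -> q ^+ m != 1) -> injective (fun n => q ^+ n).
Proof.
move=> q0 q1; suff W m n : (m < n)%N -> q ^+ m <> q ^+ n.
  move=> m n E; case: (ltngtP m n) => // /W; [by []|by move=> H; case: H].
move=> mn /eqP; rewrite -(subnKC (ltnW mn)) exprD -{1}[q ^+ m]mulr1.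
rewrite (inj_eq (mulfI _)) ?expf_neq0 // eq_sym; apply/negP/q1.
by rewrite subn_gt0.
Qed.

(* The normalized character is well defined as soon as q is nonzero and not a
   root of unity, in particular for every positive real q <> 1. *)
Lemma symp_char_principal_neq0 (lam : N.-tuple nat) (q : F) :
  sorted geq lam -> q != 0 -> (forall m, (0 < m)%N -> q ^+ m != 1) ->
  symp_char_principal lam q != 0.
Proof.
move=> slam q0 q1.
have key (l : 'I_N -> nat) : injective l -> (forall j, 0 < l j)%N ->
    \det (\matrix_(i < N, j < N) ((q ^+ i.+1) ^+ l j - (q ^+ i.+1) ^- l j)) != 0.
  move=> lI l0.
  have -> : \matrix_(i < N, j < N) ((q ^+ i.+1) ^+ l j - (q ^+ i.+1) ^- l j)
          = \matrix_(i < N, j < N) ((q ^+ l j) ^+ i.+1 - (q ^+ l j) ^- i.+1).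
    by apply/matrixP => i j; rewrite !mxE -!exprM mulnC.
  apply: det_odd_powers_neq0.
  - by move=> j k /(expf_inj q0 q1) /lI.
  - by move=> j; rewrite expf_neq0.
  - by move=> j; rewrite q1.
  - by move=> j k; rewrite -exprD q1 // addn_gt0 l0.
rewrite /symp_char_principal /symp_char mulf_neq0 ?invr_eq0 //; apply: key.
- have tg : transitive geq by move=> a b c /= ba ac; exact: leq_trans ac ba.
  have lt (j k : 'I_N) : (j < k)%N -> (shifted_part lam k < shifted_part lam j)%N.
    move=> jk; have := sorted_ltn_nth tg 0 slam.
    move=> /(_ j k); rewrite !inE !size_tuple !ltn_ord => /(_ isT isT jk).
    rewrite /= -!tnth_nth /shifted_part.
    by have := ltn_ord k; move: (tnth lam j) (tnth lam k) => u w; lia.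
  move=> j k E; apply: val_inj; case: (ltngtP j k) => //= /lt; by rewrite E ltnn.
- by move=> j; rewrite /shifted_part addn_gt0 subn_gt0 ltn_ord orbT.
- move=> j k E; apply: val_inj => /=; have := ltn_ord j; have := ltn_ord k; lia.
- by move=> j; rewrite subn_gt0.
Qed.

End NonVanishing.

Section ContourIntegral.
Variable R : realType.
Implicit Types (z w L : R[i]) (g : R -> R[i]) (f : R[i] -> R[i]) (a b : R).

Definition cexp z : R[i] :=
  (expR (complex.Re z))%:C * (cos (complex.Im z) +i* sin (complex.Im z)).

(* The power b^z of a base b = cexp L, for the branch of log b given by L. *)
Definition cpow L z : R[i] := cexp (z * L).

(* Continuously differentiable on the closed segment, one-sidedly at a and b:
   the derivative on the open segment extends continuously. *)
Definition C1_segment (h : R -> R) a b : Prop :=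
  [/\ {within `[a, b], continuous h},
      {in `]a, b[, forall t, derivable h t 1}
    & exists2 d : R -> R, {within `[a, b], continuous d}
                        & {in `]a, b[, h^`() =1 d}].

Definition piecewise_C1 (h : R -> R) a b : Prop :=
  exists2 s : seq R, itv_partition a b s &
    forall i, (i < size s)%N ->
      C1_segment h (nth b (a :: s) i) (nth b s i).

Definition closed_contour g a b : Prop :=
  [/\ piecewise_C1 (fun t => complex.Re (g t)) a b,
      piecewise_C1 (fun t => complex.Im (g t)) a b
    & g a = g b].

(* At the finitely many break points the value is irrelevant. *)
Definition velocity g (t : R) : R[i] :=
  (fun s => complex.Re (g s))^`() t +i* (fun s => complex.Im (g s))^`() t.

Definition contour_integral g a b f : R[i] :=
  (\int[lebesgue_measure]_(t in `[a, b])
      complex.Re (f (g t) * velocity g t))%R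
  +i* (\int[lebesgue_measure]_(t in `[a, b])
      complex.Im (f (g t) * velocity g t))%R.

Definition two_pi_i : R[i] := 0 +i* (2 * pi).

Definition winding_number g a b w : R[i] :=
  two_pi_i^-1 * contour_integral g a b (fun z => (z - w)^-1).

End ContourIntegral.

Section Integrand.
Variables (R : realType) (N : nat).
Implicit Types (lam : N.-tuple nat) (q Lq Lx z : R[i]).

Definition integrand_denom lam q Lq z : R[i] :=
  \prod_(i < N) (cpow Lq (z + 1) + cpow Lq (- z - 1)
                 - q ^- shifted_part lam i - q ^+ shifted_part lam i).

Definition integrand lam q Lq Lx z : R[i] :=
  (cpow Lx (z + 1) - cpow Lx (- z - 1)) / integrand_denom lam q Lq z.

(* lambda_{i+1} + N - (i+1) *)
Definition node lam (i : 'I_N) : R[i] := (tnth lam i + (N - i.+1))%:R.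

(* The contour avoids the zeros of the denominator, winds once counterclockwise
   around each node, and does not wind around any other zero.  There are always
   other zeros, since the denominator is periodic and is even in z + 1. *)
Definition contour_encloses_nodes lam q Lq (g : R -> R[i]) (a b : R) : Prop :=
  [/\ {in `[a, b], forall t, integrand_denom lam q Lq (g t) != 0},
      forall i, winding_number g a b (node lam i) = 1
    & forall w, integrand_denom lam q Lq w = 0 ->
        (forall i, w != node lam i) -> winding_number g a b w = 0].

End Integrand.

(* Main.v *)
Require Import Defs.
From mathcomp Require Import perm zify ring lra.
From mathcomp Require Import measurable_realfun separable cyclotomic.

(* With u = q^(z+1) and c(z) = u + 1/u, the integrand is a function of x^(z+1)
   over prod_i (c(z) - c_i).  Partial fractions in c(z), and then in u, reduce
   it to terms e^(Mz) / (e^(L(z-p)) - 1), whose poles are simple.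

   The residue theorem for such a term needs no Cauchy theorem.  Replace e^w by
   (1 + w/n)^n in the denominator; its poles become p + n(zeta - 1)/L for the
   n-th roots of unity zeta.  For n large, each of them is p itself, or lies far
   outside the contour, or is close to a zero of the original denominator
   different from p.  Since the winding number is locally constant and vanishes
   far away, only p contributes.  All uniform limits involved are limits of
   rational functions, so the only primitives needed are those of (z - c)^k.

   On the character side, expanding the determinant of the numerator along its
   x-row gives the same sum over the nodes, the minors being Vandermonde
   determinants in the variables c_i. *)

Set Implicit Arguments.
Unset Strict Implicit.
Unset Printing Implicit Defensive.

Import Normc.

Local Open Scope classical_set_scope.
Local Open Scope ring_scope.
Local Open Scope complex_scope.

(** * Piecewise continuously differentiable functions *)

(** The contour is only piecewise C1 and is known only through its winding numbers, which are
    integrals not known to be integers. All information must therefore come from exact integrals of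
    powers and from uniform limits. The denominator has infinitely many zeros: with each node come
    its mirror image under z+1 -> -(z+1) and all translates of both by the period 2 pi i/[Lq]. The
    substitute (1 + w/n)^n - 1 has finitely many poles and an exact partial fraction expansion over
    the n-th roots of unity. Its coefficient at the root 1 yields the residue 1/L for every n, so
    each approximating integral already equals the final value and only the integrands have to
    converge. This residue 1/[Lq] is what the prefactor ln q compensates. Roots of unity other than
    1 stay at distance at least 1/n from 1, which keeps the other poles away from p uniformly in n.
    On the character side, the factors of q, ..., q^(N-1) are common to the denominator at x and to
    the principal one; what survives is the comparison of q^N with x, and it produces the
    q-factorial and the q-Pochhammer symbols. *)

Section Breaks.
Variable R : realType.
Implicit Types (h : R -> R) (a b c d : R) (B : seq R).

Lemma C1_segmentW h a b c d :
  a <= c -> d <= b -> C1_segment h a b -> C1_segment h c d.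
Proof.
move=> ac db [hc hd [e ec eh]].
have sub : `[c, d] `<=` `[a, b].
  by apply: subset_itv; rewrite bnd_simp.
have subo : {subset `]c, d[%classic <= `]a, b[%classic}.
  move=> t; rewrite !inE/= !in_itv/= => /andP[ct td].
  by rewrite (le_lt_trans ac) ?(lt_le_trans td).
split; first exact: continuous_subspaceW hc.
- by move=> t /subo; exact: hd.
- by exists e; [exact: continuous_subspaceW ec|move=> t /subo; exact: eh].
Qed.

(** In this form only membership of a break point in an open interval matters, so the break lists of
    two functions can be combined by concatenation. *)
Lemma piecewise_C1_breaks h a b : piecewise_C1 h a b ->
  exists B, forall c d, a <= c -> c < d -> d <= b ->
    {in B, forall t, t \notin `]c, d[} -> C1_segment h c d.
Proof.
move=> [s ps H]; exists s; elim: s a ps H => [|x s IH] a ps H c d ac cd db nB.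
  by have := itv_partition_nil ps; lra.
have h0 := H 0%N isT; rewrite /= in h0.
have [dx|xd] := leP d x; first exact: C1_segmentW h0.
have xc : x <= c.
  by have := nB x (mem_head _ _); rewrite in_itv/= xd andbT -leNgt.
apply: (IH x) => //; first exact: itv_partition_cons ps.
- by move=> i; exact: (H i.+1).
- by move=> t ts; apply: nB; rewrite in_cons ts orbT.
Qed.

(* Splitting at break points one at a time avoids building a common refinement
   of the partitions for the real and imaginary parts of a contour. *)
Lemma interval_break_ind B (P : R -> R -> Prop) a b :
  (forall c, P c c) ->
  (forall c m d, c <= m -> m <= d -> P c m -> P m d -> P c d) ->
  (forall c d, a <= c -> c < d -> d <= b ->
     {in B, forall t, t \notin `]c, d[} -> P c d) ->
  a <= b -> P a b.
Proof.
move=> P0 Padd Pfree ab.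
suff W n c d : (count (fun t => t \in `]c, d[) B <= n)%N ->
    a <= c -> c <= d -> d <= b -> P c d by exact: (W _ a b (leqnn _)).
elim: n c d => [|n IH] c d cnt ac.
  rewrite le_eqVlt => /predU1P[->//|cd] db; apply: Pfree => // t tB.
  apply/negP => tcd; move: cnt; rewrite leqNgt -has_count => /hasP[].
  by exists t.
rewrite le_eqVlt => /predU1P[->//|cd] db.
have [/hasP[m mB mcd]|/hasPn nB] := boolP (has (fun t => t \in `]c, d[) B);
  last exact: Pfree.
move: (mcd); rewrite in_itv/= => /andP[cm md].
have count_lt c' d' : {subset `]c', d'[ <= `]c, d[} -> m \notin `]c', d'[ ->
    (count (fun t => t \in `]c', d'[) B <= n)%N.
  move=> sub mn; rewrite -ltnS; apply: leq_trans cnt.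
  elim: B mB {Pfree IH} => // t s IHs; rewrite in_cons.
  have le_all s' :
      (count (fun t => t \in `]c', d'[) s' <= count (fun t => t \in `]c, d[) s')%N.
    exact: sub_count.
  case/predU1P => [<-|ms] /=.
    by rewrite (negbTE mn) mcd add0n ltnS.
  by rewrite -addnS leq_add ?IHs//; case: (boolP (t \in `]c', d'[)) => // /sub ->.
apply: (Padd c m d); rewrite ?ltW//.
- apply: IH => //; rewrite ?(ltW cm) ?(le_trans (ltW md))//.
  apply: count_lt; last by rewrite in_itv/= ltxx andbF.
  by move=> t; rewrite !in_itv/= => /andP[-> /lt_trans->].
- apply: IH => //; rewrite ?(ltW md) ?(le_trans ac (ltW cm))//.
  apply: count_lt; last by rewrite in_itv/= ltxx.
  by move=> t; rewrite !in_itv/= => /andP[/(lt_trans cm) -> ->].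
Qed.

Notation mu := (@lebesgue_measure R).

Lemma integrable_oo_cc (f : R -> R) c d :
  mu.-integrable `]c, d[ (EFin \o f) -> mu.-integrable `[c, d] (EFin \o f).
Proof.
move=> /integrableP[mf foo]; apply/integrableP; split.
  apply/measurable_EFinP.
  apply/measurable_fun_itv_obnd_cbndP/measurable_fun_itv_bndo_bndcP.
  exact/measurable_EFinP.
rewrite integral_itv_bndoo//; exact: measurableT_comp.
Qed.

Lemma integrable_cat (f : R -> R) c m d : c <= m -> m <= d ->
  mu.-integrable `[c, m] (EFin \o f) -> mu.-integrable `[m, d] (EFin \o f) ->
  mu.-integrable `[c, d] (EFin \o f).
Proof.
move=> cm md /integrableP[mf1 f1] /integrableP[mf2 f2].
have E : `[c, d]%classic = `[c, m[ `|` `[m, d] :> set R.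
  by rewrite -itv_bndbnd_setU// bnd_simp.
have mf1' : measurable_fun `[c, m[ (EFin \o f).
  apply: measurable_funS mf1 => // t /=; rewrite !in_itv/= => /andP[->].
  exact: ltW.
apply/integrableP; rewrite E; split; first exact/measurable_funU.
rewrite ge0_integral_setU//.
- rewrite integral_itv_bndo_bndc; last exact: measurableT_comp.
  exact: lte_add_pinfty.
- by apply: measurableT_comp => //; exact/measurable_funU.
- apply/disj_setPS => t [/=]; rewrite !in_itv/= => /andP[_ tm] /andP[mt _].
  by move: mt; rewrite leNgt tm.
Qed.

(** The derivative [ps] is controlled only inside the segment, since at an endpoint it also sees
    values of [G] outside. Its continuous extension [ph] gives integrability and is the integrand to
    which the fundamental theorem is applied; endpoints have measure zero. *)
Lemma ftc_open (G ps ph : R -> R) c d : c < d ->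
  {within `[c, d], continuous G} ->
  {in `]c, d[, forall t, derivable G t 1} ->
  {in `]c, d[, derive1 G =1 ps} ->
  {within `[c, d], continuous ph} -> {in `]c, d[, ps =1 ph} ->
  mu.-integrable `[c, d] (EFin \o ps) /\
  (\int[mu]_(t in `[c, d]) ps t)%R = G d - G c.
Proof.
move=> cd Gc Gd GE phc psE.
have iph : mu.-integrable `[c, d] (EFin \o ph).
  by apply: continuous_compact_integrable => //; exact: segment_compact.
have iph' : mu.-integrable `]c, d[ (EFin \o ph).
  by apply: integrableS iph => //; exact: subset_itv_oo_cc.
have ips' : mu.-integrable `]c, d[ (EFin \o ps).
  by apply: eq_integrable iph' => // t; rewrite inE/= => /psE ->.
have ips := integrable_oo_cc ips'.
split => //.
rewrite /Rintegral.
rewrite (@eq_integral_itv_bounded _ _ _ ph) //.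
- rewrite (@continuous_FTC2 _ ph G)//.
  + by have [_ Gl Gr] := (continuous_within_itvP _ cd).1 Gc.
  + by move=> t tcd; rewrite GE// psE.
- by apply/measurable_EFinP; exact: measurable_int ips'.
- by apply/measurable_EFinP; exact: measurable_int iph'.
Qed.

End Breaks.

(** * Real and imaginary parts, and the real-valued modulus *)

Section ComplexModulus.
Variable R : rcfType.
Implicit Types z w : R[i].

Lemma normcD z w : normc (z + w) <= normc z + normc w.
Proof. exact: (le_normcD z w). Qed.

Lemma normcNE z : normc (- z) = normc z.
Proof. exact: (normcN z). Qed.

Lemma normcBC z w : normc (z - w) = normc (w - z).
Proof. by rewrite -normcNE opprB. Qed.

Lemma normc_ge0 z : 0 <= normc z.
Proof. by case: z => x y; exact: sqrtr_ge0. Qed.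

Lemma normcB_ge z w : normc z - normc w <= normc (z - w).
Proof. by rewrite lerBlDr -{1}(subrK w z) normcD. Qed.

Lemma normcX z n : normc (z ^+ n) = normc z ^+ n.
Proof. by elim: n => [|n IH]; rewrite ?normc1// !exprS normcM IH. Qed.

Lemma normc_gt0 z : (0 < normc z) = (z != 0).
Proof.
rewrite lt0r normc_ge0 andbT; congr negb; apply/eqP/eqP => [/eq0_normc//|->].
exact: normc0.
Qed.

Lemma normc_sum I (r : seq I) (P : pred I) (F : I -> R[i]) :
  normc (\sum_(i <- r | P i) F i) <= \sum_(i <- r | P i) normc (F i).
Proof.
elim/big_rec2 : _ => [|i y x _ IH]; first by rewrite normc0.
by apply: le_trans (normcD _ _) _; rewrite lerD2l.
Qed.

Lemma normc_Re z : `|complex.Re z| <= normc z.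
Proof.
by case: z => x y; rewrite /= -sqrtr_sqr; apply: ler_wsqrtr; rewrite lerDl sqr_ge0.
Qed.

Lemma normc_Im z : `|complex.Im z| <= normc z.
Proof.
by case: z => x y; rewrite /= -sqrtr_sqr; apply: ler_wsqrtr; rewrite lerDr sqr_ge0.
Qed.

Lemma normc_leD z : normc z <= `|complex.Re z| + `|complex.Im z|.
Proof.
case: z => x y /=; rewrite -[leRHS]ger0_norm ?addr_ge0// -[leRHS]sqrtr_sqr.
apply: ler_wsqrtr; rewrite sqrrD !real_normK ?num_real// -addrA lerD2l lerDr.
by rewrite mulrn_wge0// mulr_ge0.
Qed.

Lemma normc_real (x : R) : normc x%:C = `|x|.
Proof. by rewrite /= expr0n addr0 sqrtr_sqr. Qed.

Lemma normc_nat n : normc (n%:R : R[i]) = n%:R.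
Proof. by rewrite -(rmorph_nat (real_complex R)) normc_real ger0_norm. Qed.

Lemma ReD z w : complex.Re (z + w) = complex.Re z + complex.Re w.
Proof. by case: z w => ? ? []. Qed.

Lemma ImD z w : complex.Im (z + w) = complex.Im z + complex.Im w.
Proof. by case: z w => ? ? []. Qed.

Lemma ReM z w : complex.Re (z * w) =
  complex.Re z * complex.Re w - complex.Im z * complex.Im w.
Proof. by case: z w => ? ? []. Qed.

Lemma ImM z w : complex.Im (z * w) =
  complex.Re z * complex.Im w + complex.Im z * complex.Re w.
Proof. by case: z w => ? ? []. Qed.

Lemma ReN z : complex.Re (- z) = - complex.Re z.
Proof. by case: z. Qed.

Lemma ImN z : complex.Im (- z) = - complex.Im z.
Proof. by case: z. Qed.

Lemma ReV z : complex.Re z^-1 =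
  complex.Re z / (complex.Re z ^+ 2 + complex.Im z ^+ 2).
Proof. by case: z. Qed.

Lemma ImV z : complex.Im z^-1 =
  - complex.Im z / (complex.Re z ^+ 2 + complex.Im z ^+ 2).
Proof. by case: z => x y /=; rewrite mulNr. Qed.

Lemma complex_sqr_eq0 z :
  (complex.Re z ^+ 2 + complex.Im z ^+ 2 == 0) = (z == 0).
Proof.
by case: z => x y; rewrite /= paddr_eq0 ?sqr_ge0// !sqrf_eq0 eq_complex.
Qed.

End ComplexModulus.

(** * Continuous complex functions of a real parameter *)

Section Nice.
Variables (R : realType) (a b : R).
Implicit Types (f h : R -> R[i]).

Lemma within_continuous_eq (A : set R) (u v : R -> R) : u =1 v ->
  {within A, continuous u} -> {within A, continuous v}.
Proof. by move=> /funext ->. Qed.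

(** Continuity is kept coordinatewise because integrals and derivatives along the contour are
    defined coordinatewise. *)
Definition ccont f :=
  {within `[a, b], continuous (fun t => complex.Re (f t))} /\
  {within `[a, b], continuous (fun t => complex.Im (f t))}.

Lemma ccont_eq f h : f =1 h -> ccont f -> ccont h.
Proof. by move=> /funext ->. Qed.

Lemma ccont_cst z : ccont (fun=> z).
Proof. by split => t; exact: cst_continuous. Qed.

Lemma ccontD f h : ccont f -> ccont h -> ccont (fun t => f t + h t).
Proof.
move=> [f1 f2] [h1 h2]; split.
  by apply: within_continuous_eq (within_continuousD f1 h1) => t; rewrite ReD.
by apply: within_continuous_eq (within_continuousD f2 h2) => t; rewrite ImD.
Qed.

Lemma within_continuousM (A : set R) (u v : R -> R) :
  {within A, continuous u} -> {within A, continuous v} ->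
  {within A, continuous (fun t => u t * v t)}.
Proof.
move=> /subspace_continuousP cu /subspace_continuousP cv.
by apply/subspace_continuousP => t At; exact: cvgM (cu _ At) (cv _ At).
Qed.

Lemma ccontM f h : ccont f -> ccont h -> ccont (fun t => f t * h t).
Proof.
move=> [f1 f2] [h1 h2]; split.
  apply: within_continuous_eq (within_continuousB (within_continuousM f1 h1)
    (within_continuousM f2 h2)) => t; by rewrite ReM.
apply: within_continuous_eq (within_continuousD (within_continuousM f1 h2)
  (within_continuousM f2 h1)) => t; by rewrite ImM.
Qed.

Lemma ccontN f : ccont f -> ccont (fun t => - f t).
Proof.
move=> cf; apply: ccont_eq (ccontM (ccont_cst (-1)) cf) => t.
by rewrite mulN1r.
Qed.

Lemma ccontB f h : ccont f -> ccont h -> ccont (fun t => f t - h t).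
Proof. by move=> cf /ccontN; exact: ccontD. Qed.

Lemma ccontV f : ccont f -> {in `[a, b], forall t, f t != 0} ->
  ccont (fun t => (f t)^-1).
Proof.
move=> [f1 f2] f0.
have cD : {within `[a, b], continuous (fun t =>
    (complex.Re (f t) ^+ 2 + complex.Im (f t) ^+ 2)^-1)}.
  have c2 : {within `[a, b], continuous (fun t =>
      complex.Re (f t) ^+ 2 + complex.Im (f t) ^+ 2)}.
    by apply: within_continuousD; exact: within_continuousM.
  move/subspace_continuousP : c2 => c2.
  apply/subspace_continuousP => t At; apply: cvgV (c2 _ At).
  by rewrite /= complex_sqr_eq0 f0.
split.
  by apply: within_continuous_eq (within_continuousM f1 cD) => t; rewrite ReV.
have [_ c2] := ccontN (conj f1 f2).
apply: within_continuous_eq (within_continuousM c2 cD) => t.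
by rewrite ImV; case: (f t).
Qed.

Lemma ccontX f n : ccont f -> ccont (fun t => f t ^+ n).
Proof.
move=> cf; elim: n => [|n IH]; first exact: ccont_cst.
by apply: ccont_eq (ccontM cf IH) => t; rewrite exprS.
Qed.

Lemma ccont_sum (I : eqType) (r : seq I) (F : I -> R -> R[i]) :
  {in r, forall i, ccont (F i)} -> ccont (fun t => \sum_(i <- r) F i t).
Proof.
elim: r => [|i r IH] cF.
  by apply: ccont_eq (ccont_cst 0) => t; rewrite big_nil.
have cr : ccont (fun t => \sum_(j <- r) F j t).
  by apply: IH => j jr; apply: cF; rewrite in_cons jr orbT.
by apply: ccont_eq (ccontD (cF i (mem_head _ _)) cr) => t; rewrite big_cons.
Qed.

Lemma ccont_horner (p : {poly R[i]}) f : ccont f -> ccont (fun t => p.[f t]).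
Proof.
move=> cf.
apply: (@ccont_eq (fun t => \sum_(i < size p) p`_i * f t ^+ i)).
  by move=> t; rewrite horner_coef.
apply: ccont_sum => i _; apply: ccontM; [exact: ccont_cst|exact: ccontX].
Qed.

Lemma ccont_cexp f : ccont f -> ccont (fun t => cexp (f t)).
Proof.
move=> [f1 f2].
have ce : {within `[a, b], continuous (fun t => expR (complex.Re (f t)))}.
  by apply: (@within_continuous_comp _ _ _ _ _ expR) f1 => ? _; exact: continuous_expR.
have cc : {within `[a, b], continuous (fun t => cos (complex.Im (f t)))}.
  by apply: (@within_continuous_comp _ _ _ _ _ cos) f2 => ? _; exact: continuous_cos.
have cs : {within `[a, b], continuous (fun t => sin (complex.Im (f t)))}.
  by apply: (@within_continuous_comp _ _ _ _ _ sin) f2 => ? _; exact: continuous_sin.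
split.
  apply: within_continuous_eq (within_continuousM ce cc) => t.
  by rewrite /cexp ReM /= mul0r subr0.
apply: within_continuous_eq (within_continuousM ce cs) => t.
by rewrite /cexp ImM /= mul0r addr0.
Qed.

Lemma ccont_bounded f : a <= b -> ccont f ->
  exists2 M : R, 0 < M & {in `[a, b], forall t, normc (f t) <= M}.
Proof.
move=> ab [f1 f2].
have bnd (u : R -> R) : {within `[a, b], continuous u} ->
    exists M : R, {in `[a, b], forall t, `|u t| <= M}.
  move=> cu.
  have [c _ Hc] := EVT_max ab cu; have [e _ He] := EVT_min ab cu.
  exists (`|u c| + `|u e|) => t tab; rewrite ler_norml.
  have := Hc _ tab; have := He _ tab; have := ler_norm (u c).
  have := ler_norm (- u e); rewrite normrN.
  by have := normr_ge0 (u c); have := normr_ge0 (u e); lra.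
have [M1 H1] := bnd _ f1; have [M2 H2] := bnd _ f2.
exists (`|M1| + `|M2| + 1) => [|t tab]; first by rewrite ltr_wpDl ?addr_ge0.
apply: le_trans (normc_leD _) _; rewrite -[leLHS]addr0 lerD// lerD//.
  exact: le_trans (H1 _ tab) (ler_norm _).
exact: le_trans (H2 _ tab) (ler_norm _).
Qed.

(** The inverse is continuous on a compact segment, hence bounded; the inverse of that bound
    works. *)
Lemma ccont_lower_bound f : a <= b -> ccont f ->
  {in `[a, b], forall t, f t != 0} ->
  exists2 m : R, 0 < m & {in `[a, b], forall t, m <= normc (f t)}.
Proof.
move=> ab cf f0; have [M M0 HM] := ccont_bounded ab (ccontV cf f0).
exists M^-1 => [|t tab]; first by rewrite invr_gt0.
by rewrite -[leRHS]invrK lef_pV2 ?posrE ?invr_gt0 ?normc_gt0 ?f0// -normcV HM.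
Qed.

End Nice.

(** * The contour integral as a functional *)

Section PiecewiseC1.
Variable R : realType.
Implicit Types (h : R -> R) (c d : R).

Notation mu := (@lebesgue_measure R).

Lemma within_continuous_cat h c m d : c <= m -> m <= d ->
  {within `[c, m], continuous h} -> {within `[m, d], continuous h} ->
  {within `[c, d], continuous h}.
Proof.
move=> cm md h1 h2.
have E : `[c, d]%classic = `[c, m] `|` `[m, d] :> set R.
  apply/seteqP; split => t /=; rewrite !in_itv/=.
    by move=> /andP[-> ->]; rewrite andbT; case: (leP t m) => [|/ltW]; [left|right].
  by case=> /andP[u v]; rewrite ?u ?v ?(le_trans v md) ?(le_trans cm u).
by rewrite E; apply: withinU_continuous => //; exact: itv_closed.
Qed.

Lemma piecewise_C1_le h c d : piecewise_C1 h c d -> c <= d.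
Proof. by case=> s /itv_partition_le. Qed.

Lemma piecewise_C1_continuous h c d :
  piecewise_C1 h c d -> {within `[c, d], continuous h}.
Proof.
move=> ph; have [B HB] := piecewise_C1_breaks ph.
apply: (interval_break_ind (B := B)
  (P := fun c d => {within `[c, d], continuous h})) (piecewise_C1_le ph).
- by move=> e; rewrite set_itv1; exact: continuous_subspace1.
- by move=> e m f em mf; exact: within_continuous_cat.
- by move=> e f ce ef fd nB; have [] := HB e f ce ef fd nB.
Qed.

Lemma C1_segment_integrable h c d : c < d ->
  C1_segment h c d -> mu.-integrable `[c, d] (EFin \o derive1 h).
Proof.
move=> cd [hc hd [e ec eh]].
have [] // := @ftc_open _ h (derive1 h) e c d cd hc _ _ ec _.
- by move=> t tcd; apply: hd; rewrite inE.
- by move=> t tcd; apply: eh; rewrite inE.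
Qed.

Lemma integrable_set1 h c : mu.-integrable `[c, c] (EFin \o h).
Proof.
rewrite set_itv1; apply: null_set_integrable => //; last exact: lebesgue_measure_set1.
exact: measurable_fun_set1.
Qed.

Lemma piecewise_C1_integrable h c d :
  piecewise_C1 h c d -> mu.-integrable `[c, d] (EFin \o derive1 h).
Proof.
move=> ph; have [B HB] := piecewise_C1_breaks ph.
apply: (interval_break_ind (B := B)
  (P := fun c d => mu.-integrable `[c, d] (EFin \o derive1 h)))
  (piecewise_C1_le ph).
- by move=> e; exact: integrable_set1.
- by move=> e m f em mf; exact: integrable_cat.
- by move=> e f ce ef fd nB; apply: C1_segment_integrable => //; exact: HB.
Qed.

End PiecewiseC1.

(** * Linearity, norm bound, uniform limits and primitives for integrals along a contour *)

Section Contour.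
Variables (R : realType) (g : R -> R[i]) (a b : R).
Hypothesis gC : closed_contour g a b.
Implicit Types (f : R -> R[i]).

Notation mu := (@lebesgue_measure R).
Notation xg := (fun t => complex.Re (g t)).
Notation yg := (fun t => complex.Im (g t)).

(** The argument is a function of the parameter t, so it needs to be continuous along the contour
    only. For [fun t => f (g t)] this is [contour_integral g a b f] by unfolding. *)
Definition cint f : R[i] :=
  (\int[mu]_(t in `[a, b]) complex.Re (f t * velocity g t))%R
  +i* (\int[mu]_(t in `[a, b]) complex.Im (f t * velocity g t))%R.

Lemma closed_contour_le : a <= b.
Proof. by case: gC => /piecewise_C1_le. Qed.

Lemma closed_contour_breaks : exists B : seq R,
  forall c d, a <= c -> c < d -> d <= b -> {in B, forall t, t \notin `]c, d[} ->
  C1_segment xg c d /\ C1_segment yg c d.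
Proof.
case: gC => /piecewise_C1_breaks[B1 H1] /piecewise_C1_breaks[B2 H2] _.
exists (B1 ++ B2) => c d ac cd db nB; split; [apply: H1|apply: H2] => // t tB;
  by apply: nB; rewrite mem_cat tB ?orbT.
Qed.

Lemma contour_ccont : ccont a b g.
Proof. by case: gC => px py _; split; exact: piecewise_C1_continuous. Qed.

Lemma velocity_integrable :
  mu.-integrable `[a, b] (EFin \o derive1 xg) /\
  mu.-integrable `[a, b] (EFin \o derive1 yg).
Proof. by case: gC => px py _; split; exact: piecewise_C1_integrable. Qed.

Lemma integrableM_continuous (u v : R -> R) : {within `[a, b], continuous u} ->
  mu.-integrable `[a, b] (EFin \o v) ->
  mu.-integrable `[a, b] (EFin \o (fun t => u t * v t)).
Proof.
move=> cu iv; rewrite (_ : _ \o _ = ((EFin \o u) \* (EFin \o v))%E); last first.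
  by apply/funext => t /=; rewrite EFinM.
apply: integrableMr => //.
  by apply: subspace_continuous_measurable_fun.
have [M _ HM] := ccont_bounded closed_contour_le
  (conj cu (ccont_cst a b 0).2 : ccont a b (fun t => (u t)%:C)).
exists M; split; first exact: num_real.
move=> x Mx t /= tab; apply: le_trans (ltW Mx).
by have := HM t tab; rewrite normc_real.
Qed.

Lemma cint_integrable f : ccont a b f ->
  mu.-integrable `[a, b] (EFin \o (fun t => complex.Re (f t * velocity g t))) /\
  mu.-integrable `[a, b] (EFin \o (fun t => complex.Im (f t * velocity g t))).
Proof.
move=> [f1 f2]; have [vx vy] := velocity_integrable.
split.
  rewrite (_ : _ \o _ = (fun t => (complex.Re (f t) * derive1 xg t)%:E -
    (complex.Im (f t) * derive1 yg t)%:E)%E); last first.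
    by apply/funext => t /=; rewrite ReM.
  by apply: integrableB => //; exact: integrableM_continuous.
rewrite (_ : _ \o _ = (fun t => (complex.Re (f t) * derive1 yg t)%:E +
  (complex.Im (f t) * derive1 xg t)%:E)%E); last first.
  by apply/funext => t /=; rewrite ImM.
by apply: integrableD => //; exact: integrableM_continuous.
Qed.

Lemma eq_cint f1 f2 : {in `[a, b], f1 =1 f2} -> cint f1 = cint f2.
Proof.
move=> E; rewrite /cint; congr (_ +i* _).
  by apply: eq_Rintegral => t; rewrite inE => /E ->.
by apply: eq_Rintegral => t; rewrite inE => /E ->.
Qed.

Lemma cintD f1 f2 : ccont a b f1 -> ccont a b f2 ->
  cint (fun t => f1 t + f2 t) = cint f1 + cint f2.
Proof.
move=> /cint_integrable[r1 i1] /cint_integrable[r2 i2].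
rewrite /cint -[RHS]/(_ +i* _) -!RintegralD//; congr (_ +i* _);
  by apply: eq_Rintegral => t _; rewrite mulrDl (ReD, ImD).
Qed.

Lemma integrable_scale (k : R) (h : R -> R) : mu.-integrable `[a, b] (EFin \o h) ->
  mu.-integrable `[a, b] (EFin \o (fun t => k * h t)).
Proof. exact: integrableZl. Qed.

Lemma cintZ c f : ccont a b f -> cint (fun t => c * f t) = c * cint f.
Proof.
case: c => p q /cint_integrable[r i].
rewrite /cint -[RHS]/(_ +i* _) -!RintegralZl// -RintegralB -?RintegralD//;
  try exact: integrable_scale.
congr (_ +i* _); apply: eq_Rintegral => t _; by rewrite -mulrA (ReM, ImM).
Qed.

Lemma cint0 : cint (fun=> 0) = 0.
Proof.
rewrite -[RHS](mul0r (cint (fun=> 0))) -cintZ; last exact: ccont_cst.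
by apply: eq_cint => t _; rewrite mul0r.
Qed.

Lemma cintB f1 f2 : ccont a b f1 -> ccont a b f2 ->
  cint (fun t => f1 t - f2 t) = cint f1 - cint f2.
Proof.
move=> c1 c2; rewrite -mulN1r -cintZ// -cintD//; last exact: ccontM (ccont_cst _ _ _) c2.
by apply: eq_cint => t _; rewrite mulN1r.
Qed.

Lemma cint_sum (I : eqType) (r : seq I) (F : I -> R -> R[i]) :
  {in r, forall i, ccont a b (F i)} ->
  cint (fun t => \sum_(i <- r) F i t) = \sum_(i <- r) cint (F i).
Proof.
elim: r => [|i r IH] cF.
  by rewrite [RHS]big_nil -[RHS]cint0; apply: eq_cint => t _; rewrite big_nil.
have cr : {in r, forall j, ccont a b (F j)}.
  by move=> j jr; apply: cF; rewrite in_cons jr orbT.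
rewrite [RHS]big_cons -IH// -cintD; [|exact/cF/mem_head|exact: ccont_sum].
by apply: eq_cint => t _; rewrite big_cons.
Qed.

(** [K] depends on the contour alone: the integral [V] of |x'| + |y'| bounds its length, the factor
    2 comes from estimating real and imaginary parts separately, and the summand 1 makes [K]
    positive. *)
Lemma cint_bounded : exists2 K : R, 0 < K & forall f e, ccont a b f -> 0 <= e ->
  {in `[a, b], forall t, normc (f t) <= e} -> normc (cint f) <= K * e.
Proof.
have [vx vy] := velocity_integrable.
have iN (h : R -> R) : mu.-integrable `[a, b] (EFin \o h) ->
    mu.-integrable `[a, b] (EFin \o (fun t => `|h t|)).
  exact: integrable_norm.
set V := (\int[mu]_(t in `[a, b]) (`|derive1 xg t| + `|derive1 yg t|))%R.
have V0 : 0 <= V by apply: Rintegral_ge0 => t _; rewrite addr_ge0.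
have iV : mu.-integrable `[a, b] (EFin \o (fun t => `|derive1 xg t| + `|derive1 yg t|)).
  rewrite (_ : _ \o _ = (fun t => `|derive1 xg t|%:E + `|derive1 yg t|%:E)%E)//.
  by apply: integrableD => //; exact: iN.
exists (2 * V + 1) => [|f e cf e0 fe]; first by rewrite ltr_wpDl// mulr_ge0.
have [ir ii] := cint_integrable cf.
have bnd (h : R -> R) : mu.-integrable `[a, b] (EFin \o h) ->
    {in `[a, b], forall t, `|h t| <= e * (`|derive1 xg t| + `|derive1 yg t|)} ->
    `|\int[mu]_(t in `[a, b]) h t|%R <= e * V.
  move=> ih hb; apply: le_trans (le_normr_Rintegral _ ih) _ => //.
  rewrite /V -RintegralZl//; apply: le_Rintegral => //; first exact: iN.
  exact: integrable_scale.
have vb t : t \in `[a, b] ->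
    normc (f t * velocity g t) <= e * (`|derive1 xg t| + `|derive1 yg t|).
  move=> tab; rewrite normcM ler_pM ?normc_ge0 ?fe//.
  exact: normc_leD.
apply: le_trans (normc_leD _) _.
have B1 : `|complex.Re (cint f)| <= e * V.
  by apply: bnd => // t tab; apply: le_trans (normc_Re _) (vb _ tab).
have B2 : `|complex.Im (cint f)| <= e * V.
  by apply: bnd => // t tab; apply: le_trans (normc_Im _) (vb _ tab).
by nra.
Qed.

(** Every later limit passes through this form: the approximants all have integral exactly [v], so
    only their uniform distance to [f] matters. *)
Lemma cint_closed f v : ccont a b f ->
  (forall e : R, 0 < e -> exists f', [/\ ccont a b f', cint f' = v &
     {in `[a, b], forall t, normc (f t - f' t) <= e}]) ->
  cint f = v.
Proof.
move=> cf H; have [K K0 HK] := cint_bounded.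
apply/eqP; rewrite -subr_eq0; apply/eqP/eq0_normc/eqP; rewrite eq_le normc_ge0 andbT.
apply/ler_addgt0Pr => e e0; rewrite add0r.
have [|f' [cf' <- ff']] := H (e / K); first by rewrite divr_gt0.
rewrite -cintB//; apply: le_trans (HK _ (e / K) _ _ _) _ => //.
- exact: ccontB.
- by rewrite divr_ge0// ltW.
- by rewrite mulrCA divff ?mulr1// gt_eqF.
Qed.

Definition cderiv f (t : R) (v : R[i]) :=
  is_derive t 1 (fun s => complex.Re (f s)) (complex.Re v) /\
  is_derive t 1 (fun s => complex.Im (f s)) (complex.Im v).

(** The fundamental theorem holds on each segment free of break points, and the increments of [F]
    add up. The derivative of [F] is required only where the contour itself is differentiable. *)
Lemma cint_primitive F f : ccont a b F -> ccont a b f ->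
  {in `]a, b[, forall t, derivable xg t 1 -> derivable yg t 1 ->
     cderiv F t (f t * velocity g t)} ->
  cint f = F b - F a.
Proof.
move=> [F1 F2] [f1 f2] FD.
have [B HB] := closed_contour_breaks.
have ab := closed_contour_le.
have inc c d t : a <= c -> d <= b -> t \in `]c, d[ -> t \in `]a, b[.
  by move=> ac db; rewrite !in_itv/= => /andP[/(le_lt_trans ac) -> /lt_le_trans->].
have cW c d (h : R -> R) : a <= c -> d <= b -> {within `[a, b], continuous h} ->
    {within `[c, d], continuous h}.
  move=> ac db; apply: continuous_subspaceW.
  by apply: subset_itv; rewrite bnd_simp.
have add (G ps : R -> R) :
    (forall c d, a <= c -> c < d -> d <= b -> {in B, forall t, t \notin `]c, d[} ->
      mu.-integrable `[c, d] (EFin \o ps) /\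
      (\int[mu]_(t in `[c, d]) ps t)%R = G d - G c) ->
    (\int[mu]_(t in `[a, b]) ps t)%R = G b - G a.
  move=> H.
  have [] // : mu.-integrable `[a, b] (EFin \o ps) /\
      (\int[mu]_(t in `[a, b]) ps t)%R = G b - G a.
  apply: (interval_break_ind (B := B) (P := fun c d =>
    mu.-integrable `[c, d] (EFin \o ps) /\
    (\int[mu]_(t in `[c, d]) ps t)%R = G d - G c)) => //.
    move=> c; split; first exact: integrable_set1.
    by rewrite set_itv1 Rintegral_set1 subrr.
  move=> c m d cm md [i1 e1] [i2 e2].
  have i := integrable_cat cm md i1 i2; split => //.
  have := Rintegral_itvB i (_ : BLeft c <= BRight m)%O (_ : BRight m <= BRight d)%O.
  rewrite !bnd_simp => /(_ cm md); rewrite e1 Rintegral_itv_obnd_cbnd.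
    by rewrite e2; lra.
  by apply: integrableS i2 => //; apply: subset_itvr; rewrite bnd_simp.
rewrite /cint (_ : F b - F a = (complex.Re (F b) - complex.Re (F a)) +i*
   (complex.Im (F b) - complex.Im (F a))); last by case: (F b) (F a) => ? ? [].
congr (_ +i* _).
- apply: (add (fun t => complex.Re (F t))) => c d ac cd db nB.
  have [[_ dx [ex cex Ex]] [_ dy [ey cey Ey]]] := HB c d ac cd db nB.
  have der t : t \in `]c, d[ -> cderiv F t (f t * velocity g t).
    move=> tcd; apply: FD; [exact: inc tcd|apply: dx|apply: dy]; by rewrite inE.
  (* [ex] and [ey] extend the coordinate velocities continuously to the closed segment, so the third
     function is the continuous extension of the integrand. *)
  refine (@ftc_open _ (fun t => complex.Re (F t))
    (fun t => complex.Re (f t * velocity g t))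
    (fun t => complex.Re (f t) * ex t - complex.Im (f t) * ey t)
    c d cd _ _ _ _ _).
  + exact: cW F1.
  + by move=> t /der[[]].
  + by move=> t /der[]; rewrite derive1E => -[_ ->].
  + by apply: within_continuousB; apply: within_continuousM => //; exact: cW.
  + by move=> t tcd; rewrite ReM -Ex ?inE// -Ey ?inE.
- apply: (add (fun t => complex.Im (F t))) => c d ac cd db nB.
  have [[_ dx [ex cex Ex]] [_ dy [ey cey Ey]]] := HB c d ac cd db nB.
  have der t : t \in `]c, d[ -> cderiv F t (f t * velocity g t).
    move=> tcd; apply: FD; [exact: inc tcd|apply: dx|apply: dy]; by rewrite inE.
  refine (@ftc_open _ (fun t => complex.Im (F t))
    (fun t => complex.Im (f t * velocity g t))
    (fun t => complex.Re (f t) * ey t + complex.Im (f t) * ex t)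
    c d cd _ _ _ _ _).
  + exact: cW F2.
  + by move=> t /der[_ []].
  + by move=> t /der[_]; rewrite derive1E => -[_ ->].
  + by apply: within_continuousD; apply: within_continuousM => //; exact: cW.
  + by move=> t tcd; rewrite ImM -Ex ?inE// -Ey ?inE.
Qed.

End Contour.

(** * Integrals of powers, and the winding number as a function of the point *)

Section ContourPowers.
Variables (R : realType) (g : R -> R[i]) (a b : R).
Hypothesis gC : closed_contour g a b.
Implicit Types (f h : R -> R[i]) (c : R[i]).

Lemma cderiv_cst c (t : R) : cderiv (fun=> c) t 0.
Proof. by split; exact: is_derive_cst. Qed.

Lemma cderivD f h (t : R) u v : cderiv f t u -> cderiv h t v ->
  cderiv (fun s => f s + h s) t (u + v).
Proof.
move=> [f1 f2] [h1 h2]; split.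
  rewrite ReD (_ : (fun s => _) = (fun s => complex.Re (f s)) + (fun s => complex.Re (h s))).
    exact: is_deriveD.
  by apply/funext => s; rewrite ReD.
rewrite ImD (_ : (fun s => _) = (fun s => complex.Im (f s)) + (fun s => complex.Im (h s))).
  exact: is_deriveD.
by apply/funext => s; rewrite ImD.
Qed.

Lemma cderivM f h (t : R) u v : cderiv f t u -> cderiv h t v ->
  cderiv (fun s => f s * h s) t (f t * v + u * h t).
Proof.
move=> [f1 f2] [h1 h2]; split.
  rewrite (_ : (fun s => _) = (fun s => complex.Re (f s)) * (fun s => complex.Re (h s))
     - (fun s => complex.Im (f s)) * (fun s => complex.Im (h s))); last first.
    by apply/funext => s; rewrite ReM.
  apply: is_derive_eq (is_deriveB (is_deriveM f1 h1) (is_deriveM f2 h2)) _.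
  by rewrite ReD !ReM /GRing.scale/=; ring.
rewrite (_ : (fun s => _) = (fun s => complex.Re (f s)) * (fun s => complex.Im (h s))
   + (fun s => complex.Im (f s)) * (fun s => complex.Re (h s))); last first.
  by apply/funext => s; rewrite ImM.
apply: is_derive_eq (is_deriveD (is_deriveM f1 h2) (is_deriveM f2 h1)) _.
by rewrite ImD !ImM /GRing.scale/=; ring.
Qed.

Lemma cderivV f (t : R) u : f t != 0 -> cderiv f t u ->
  cderiv (fun s => (f s)^-1) t (- (f t)^-1 ^+ 2 * u).
Proof.
move=> ft0 [f1 f2].
pose D (s : R) := complex.Re (f s) * complex.Re (f s) +
   complex.Im (f s) * complex.Im (f s).
have Dt : D t = complex.Re (f t) ^+ 2 + complex.Im (f t) ^+ 2 by [].
have Dt0 : complex.Re (f t) ^+ 2 + complex.Im (f t) ^+ 2 != 0 by rewrite complex_sqr_eq0.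
have dV := @is_deriveV _ D t _ 1 Dt0 (is_deriveD (is_deriveM f1 f1) (is_deriveM f2 f2)).
split.
  rewrite (_ : (fun s => _) = (fun s => complex.Re (f s)) * (fun s => (D s)^-1)); last first.
    by apply/funext => s; rewrite ReV.
  apply: is_derive_eq (is_deriveM f1 dV) _.
  by rewrite [_^-1 ^+ 2]expr2 !(ReN, ReM, ImM, ImN, mulNr) !ReV !ImV Dt /GRing.scale/=; field.
rewrite (_ : (fun s => _) = - ((fun s => complex.Im (f s)) * (fun s => (D s)^-1))); last first.
  by apply/funext => s; rewrite ImV mulNr.
apply: is_derive_eq (is_deriveN (is_deriveM f2 dV)) _.
by rewrite [_^-1 ^+ 2]expr2 !(ReN, ReM, ImM, ImN, mulNr) !ReV !ImV Dt /GRing.scale/=; field.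
Qed.

Lemma cderivX f (t : R) u k : cderiv f t u ->
  cderiv (fun s => f s ^+ k.+1) t (k.+1%:R * f t ^+ k * u).
Proof.
move=> fd; elim: k => [|k IH]; first by rewrite mul1r mul1r; under eq_fun do rewrite expr1.
rewrite (_ : (fun s => _) = (fun s => f s * f s ^+ k.+1)); last first.
  by apply/funext => s; rewrite exprS.
rewrite (_ : _ * u = f t * (k.+1%:R * f t ^+ k * u) + u * f t ^+ k.+1); first exact: cderivM.
by rewrite -[k.+2%:R]natr1 !exprS; ring.
Qed.

Lemma cderiv_contour (t : R) :
  derivable (fun s => complex.Re (g s)) t 1 -> derivable (fun s => complex.Im (g s)) t 1 ->
  cderiv g t (velocity g t).
Proof.
by move=> dx dy; split; rewrite /velocity /= derive1E; exact: derivableP.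
Qed.

(** The integrand has primitive h^(k+1)/(k+1) along the contour. Taking h = g gives the monomials,
    and h = (g - c)^-1 with u = -(g - c)^-2 gives the negative powers of exponent at least 2. *)
Lemma cint_power h u k : h a = h b -> ccont a b h -> ccont a b u ->
  {in `]a, b[, forall t, derivable (fun s => complex.Re (g s)) t 1 ->
     derivable (fun s => complex.Im (g s)) t 1 ->
     cderiv h t (u t * velocity g t)} ->
  cint g a b (fun t => h t ^+ k * u t) = 0.
Proof.
move=> hab ch cu hd.
have k0 : k.+1%:R != 0 :> R[i] by rewrite pnatr_eq0.
rewrite (cint_primitive gC (F := fun t => k.+1%:R^-1 * h t ^+ k.+1)).
- by rewrite hab subrr.
- by apply: ccontM; [exact: ccont_cst|exact: ccontX].
- by apply: ccontM => //; exact: ccontX.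
- move=> t tab dx dy; move: (velocity g t) (hd t tab dx dy) => v hv.
  have := cderivM (cderiv_cst k.+1%:R^-1 t) (cderivX k hv).
  by rewrite mul0r addr0 -[k.+1%:R * _ * _]mulrA (mulKf k0) mulrA.
Qed.

Lemma contour_closed : g a = g b. Proof. by case: gC. Qed.

Lemma cint_polynomial (p : {poly R[i]}) : cint g a b (fun t => p.[g t]) = 0.
Proof.
have cg := contour_ccont gC.
transitivity (cint g a b (fun t => \sum_(i < size p) p`_i * g t ^+ i)).
  by apply: eq_cint => t _; rewrite horner_coef.
rewrite (cint_sum gC) => [|i _]; last by apply: ccontM; [exact: ccont_cst|exact: ccontX].
rewrite big1// => i _; rewrite (cintZ gC); last exact: ccontX.
rewrite (_ : cint _ _ _ _ = 0) ?mulr0//.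
rewrite -(@cint_power g (fun=> 1) i contour_closed cg).
- by apply: eq_cint => t _; rewrite mulr1.
- exact: ccont_cst.
- by move=> t tab dx dy; rewrite mul1r; exact: cderiv_contour.
Qed.

Lemma ccont_inv_sub c : {in `[a, b], forall t, g t != c} ->
  ccont a b (fun t => (g t - c)^-1).
Proof.
move=> gc; apply: ccontV; last by move=> t /gc; rewrite subr_eq0.
by apply: ccontB (ccont_cst _ _ _); exact: contour_ccont.
Qed.

Lemma cint_neg_power c k : {in `[a, b], forall t, g t != c} ->
  cint g a b (fun t => (g t - c)^-1 ^+ k.+2) = 0.
Proof.
move=> gc; have ch := ccont_inv_sub gc.
have cu := ccontM (ccont_cst a b (-1)) (ccontX 2 ch).
rewrite -[RHS](mulr0 (-1)) -(@cint_power (fun t => (g t - c)^-1) _ k _ ch cu).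
- rewrite -(cintZ gC); last by apply: ccontM => //; exact: ccontX.
  by apply: eq_cint => t _; rewrite !mulN1r mulrN opprK -exprD addn2.
- by rewrite contour_closed.
- move=> t tab dx dy; rewrite mulN1r.
  apply: cderivV; first by rewrite subr_eq0 gc// (subset_itv_oo_cc tab).
  have := cderivD (cderiv_contour dx dy) (cderiv_cst (- c) t).
  by rewrite addr0.
Qed.

Lemma inv_sub_geometric (u e : R[i]) n : u != 0 -> u - e != 0 ->
  (u - e)^-1 = \sum_(k < n) e ^+ k * u^-1 ^+ k.+1 + (e / u) ^+ n * (u - e)^-1.
Proof.
move=> u0 ue; elim: n => [|n IH]; first by rewrite big_ord0 add0r mul1r.
rewrite big_ord_recr/= {1}IH -addrA; congr (_ + _).
rewrite !exprMn !exprS; set A := e ^+ n; set B := u^-1 ^+ n.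
by field; rewrite u0 ue.
Qed.

Lemma half_expr_small (M e : R) : 0 < e -> exists n, M * 2^-1 ^+ n <= e.
Proof.
move=> e0; have [M0|M0] := leP M 0; first by exists 0%N; rewrite mulr1; lra.
set n := (Num.truncn (M / e)).+1; exists n.
have Me : M / e < n%:R by exact: truncnS_gt.
have n2 : n%:R <= 2 ^+ n :> R by rewrite -natrX ler_nat ltnW// ltn_expl.
rewrite exprVn ler_pdivrMr ?exprn_gt0// mulrC -ler_pdivrMr//.
exact: ltW (lt_le_trans Me n2).
Qed.

(** Local constancy of the winding number: in the expansion of (g - c')^-1 in powers of (c' - c)/(g
    - c), whose ratio is at most 1/2, every term after the first has a primitive. *)
Lemma cint_inv_const c c' d : 0 < d ->
  {in `[a, b], forall t, d <= normc (g t - c)} -> normc (c' - c) <= d / 2 ->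
  {in `[a, b], forall t, g t != c'} /\
  cint g a b (fun t => (g t - c')^-1) = cint g a b (fun t => (g t - c)^-1).
Proof.
move=> d0 dc cc'.
have gc : {in `[a, b], forall t, g t != c}.
  move=> t tab; rewrite -subr_eq0 -normc_gt0; exact: lt_le_trans (dc t tab).
have dc' : {in `[a, b], forall t, d / 2 <= normc (g t - c')}.
  move=> t tab; have := normcB_ge (g t - c) (c' - c); have := dc t tab.
  by rewrite opprB addrA subrK; lra.
have gc' : {in `[a, b], forall t, g t != c'}.
  move=> t tab; rewrite -subr_eq0 -normc_gt0; apply: lt_le_trans (dc' t tab).
  by lra.
split=> //; apply: (cint_closed gC); first exact: ccont_inv_sub.
move=> e e0; have [n Hn] := half_expr_small (2 / d) e0.
(* With [n.+1] terms the leading one is present even for n = 0; the additional factor in the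
   remainder is at most 1. The constant 2/d bounds (g - c')^-1. *)
exists (fun t => \sum_(k < n.+1) (c' - c) ^+ k * (g t - c)^-1 ^+ k.+1).
have ch := ccont_inv_sub gc.
have ck k : ccont a b (fun t => (c' - c) ^+ k * (g t - c)^-1 ^+ k.+1).
  by apply: ccontM; [exact: ccont_cst|exact: ccontX].
split; first by apply: ccont_sum => k _.
- rewrite (cint_sum gC) => [|k _]//; rewrite big_ord_recl/= big1 ?addr0 => [|i _].
    by apply: eq_cint => t _; rewrite mul1r.
  by rewrite (cintZ gC) ?cint_neg_power ?mulr0//; exact: ccontX.
- move=> t tab; have gt0 := gc t tab; have gt0' := gc' t tab.
  rewrite -subr_eq0 in gt0; rewrite -subr_eq0 in gt0'.
  have E : g t - c' = g t - c - (c' - c) by rewrite opprB addrA subrK.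
  rewrite {1}E (@inv_sub_geometric _ _ n.+1) -?E// addrAC subrr add0r.
  rewrite normcM normcX normcM !normcV; apply: le_trans Hn.
  rewrite mulrC; apply: ler_pM; rewrite ?invr_ge0 ?exprn_ge0 ?normc_ge0//.
  + by rewrite divr_ge0 ?normc_ge0.
  + rewrite -[leRHS]invf_div lef_pV2 ?posrE ?dc'//; first by rewrite normc_gt0.
    by rewrite divr_gt0.
  + have q0 : normc (c' - c) / normc (g t - c) <= 2^-1.
      rewrite ler_pdivrMr ?normc_gt0//; have := dc t tab; lra.
    have q1 : 0 <= normc (c' - c) / normc (g t - c) by rewrite divr_ge0 ?normc_ge0.
    apply: (@le_trans _ _ ((normc (c' - c) / normc (g t - c)) ^+ n)).
      by rewrite exprS ler_piMl ?exprn_ge0//; lra.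
    by rewrite lerXn2r ?nnegrE// invr_ge0.
Qed.

(** Since |g/c| <= 1/2, the geometric series in g/c approximates (g - c)^-1 uniformly by polynomials
    in g, and their integrals vanish. *)
Lemma cint_inv_far c r : 0 < r -> {in `[a, b], forall t, normc (g t) <= r} ->
  2 * r <= normc c ->
  {in `[a, b], forall t, g t != c} /\ cint g a b (fun t => (g t - c)^-1) = 0.
Proof.
move=> r0 gr rc.
have c0 : c != 0 by rewrite -normc_gt0; lra.
have gc : {in `[a, b], forall t, g t != c}.
  by move=> t /gr; apply: contraTneq => ->; rewrite -ltNge; lra.
have dc : {in `[a, b], forall t, r <= normc (g t - c)}.
  by move=> t /gr; rewrite normcBC; have := normcB_ge c (g t); lra.
split=> //; apply: (cint_closed gC); first exact: ccont_inv_sub.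
move=> e e0; have [n Hn] := half_expr_small r^-1 e0.
exists (fun t => (- \poly_(k < n.+1) c^-1 ^+ k.+1).[g t]); split.
- by apply: ccont_horner; exact: contour_ccont.
- exact: cint_polynomial.
- move=> t tab; have gt0 := gc t tab.
  have cg : c - g t != 0 by rewrite subr_eq0 eq_sym.
  rewrite hornerN horner_poly opprK -opprB invrN.
  rewrite {1}(@inv_sub_geometric _ _ n.+1 c0 cg) opprD addrAC.
  rewrite [X in normc (X + _)](_ : _ = 0) ?add0r; last first.
    apply/eqP; rewrite addrC subr_eq0; apply/eqP; apply: eq_bigr => k _.
    by rewrite mulrC.
  rewrite normcNE normcM normcX normcM !normcV normcBC; apply: le_trans Hn.
  rewrite mulrC; apply: ler_pM; rewrite ?invr_ge0 ?exprn_ge0 ?normc_ge0//.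
  + by rewrite divr_ge0 ?normc_ge0.
  + by rewrite lef_pV2 ?posrE ?dc// normc_gt0 subr_eq0.
  + have q0 : normc (g t) / normc c <= 2^-1.
      by rewrite ler_pdivrMr ?normc_gt0//; have := gr t tab; lra.
    have q1 : 0 <= normc (g t) / normc c by rewrite divr_ge0 ?normc_ge0.
    apply: (@le_trans _ _ ((normc (g t) / normc c) ^+ n)).
      by rewrite exprS ler_piMl ?exprn_ge0//; lra.
    by rewrite lerXn2r ?nnegrE// invr_ge0.
Qed.

End ContourPowers.

(** * The complex exponential *)

Section ComplexExp.
Variable R : realType.
Implicit Types (z w u v : R[i]) (x y r : R).

Lemma cexpD z w : cexp (z + w) = cexp z * cexp w.
Proof.
case: z w => [x y] [x' y']; rewrite /cexp /= expRD cosD sinD; simpc.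
by congr (_ +i* _); ring.
Qed.

Lemma cexp0 : cexp 0 = 1 :> R[i].
Proof. by rewrite /cexp /= expR0 cos0 sin0; simpc. Qed.

Lemma cexpN z : cexp (- z) = (cexp z)^-1.
Proof.
have H : cexp z * cexp (- z) = 1 by rewrite -cexpD subrr cexp0.
have z0 : cexp z != 0 by apply: contra_eq_neq H => ->; rewrite mul0r eq_sym oner_eq0.
by apply: (mulfI z0); rewrite H divff.
Qed.

Lemma cexp_neq0 z : cexp z != 0.
Proof.
have H : cexp z * cexp (- z) = 1 by rewrite -cexpD subrr cexp0.
by apply: contra_eq_neq H => ->; rewrite mul0r eq_sym oner_eq0.
Qed.

Lemma cexpX z n : cexp (z *+ n) = cexp z ^+ n.
Proof. by elim: n => [|n IH]; rewrite ?cexp0// mulrS cexpD IH exprS. Qed.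

Lemma normc_cexp z : normc (cexp z) = expR (complex.Re z).
Proof.
rewrite /cexp normcM normc_real ger0_norm ?expR_ge0//= cos2Dsin2.
by rewrite sqrtr1 mulr1.
Qed.

Lemma normc_cexp_le z : normc (cexp z) <= expR (normc z).
Proof. by rewrite normc_cexp ler_expR; apply: le_trans (ler_norm _) (normc_Re z). Qed.

(** From 1 + x <= e^x <= 1/(1 - x), the error lies between 0 and x^2/(1 - x), and 1 - x >= 1/2. *)
Lemma expR_quadratic x r : `|x| <= r -> r <= 2^-1 -> `|expR x - 1 - x| <= 2 * r ^+ 2.
Proof.
move=> xr r2; have h1 := expR_ge1Dx x; have h2 := expR_ge1Dx (- x).
move: xr; rewrite ler_norml => /andP[x1 x2].
rewrite ger0_norm; last lra.
have x0 : 0 < 1 - x by lra.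
have E : expR x * (1 - x) <= 1.
  apply: (@le_trans _ _ (expR x * expR (- x))); first by rewrite ler_pM2l ?expR_gt0.
  by rewrite -expRD subrr expR0.
by nra.
Qed.

Lemma sin_lip y : `|sin y| <= `|y|.
Proof.
wlog y0 : y / 0 <= y => [H|].
  have [/H//|/ltW y0] := leP 0 y.
  by have := H (- y); rewrite sinN !normrN; apply; rewrite oppr_ge0.
have [c _] := MVT_segment y0 (fun x _ => is_derive_sin x)
  (continuous_subspaceT (@continuous_sin R)).
rewrite sin0 !subr0 => ->; rewrite normrM ler_piMl//; exact: cos_max.
Qed.

Lemma cos_quadratic y r : `|y| <= r -> `|cos y - 1| <= r ^+ 2.
Proof.
move=> yr; have E : cos y - 1 = - (2 * sin (y / 2) ^+ 2).
  rewrite {1}(_ : y = y / 2 + y / 2); last by field.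
  by rewrite cosD; have := cos2Dsin2 (y / 2); nra.
have s0 : 0 <= 2 * sin (y / 2) ^+ 2 by apply: mulr_ge0 => //; exact: sqr_ge0.
rewrite E normrN ger0_norm//.
have := sin_lip (y / 2); rewrite normrM [`|2^-1|]ger0_norm// => H.
rewrite -[sin _ ^+ 2]real_normK ?num_real//.
by have := normr_ge0 (sin (y / 2)); have := normr_ge0 y; nra.
Qed.

Lemma sin_quadratic y r : `|y| <= r -> r <= 2^-1 -> `|sin y - y| <= r ^+ 2.
Proof.
wlog y0 : y / 0 <= y => [H|].
  have [/H//|/ltW y0] := leP 0 y.
  have := H (- y); rewrite sinN normrN -opprD normrN; apply; by rewrite oppr_ge0.
move=> yr r2.
have [c] := MVT_segment y0 (fun x _ => is_derive_sin x)
  (continuous_subspaceT (@continuous_sin R)).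
rewrite in_itv/= sin0 !subr0 => /andP[c0 cy] ->.
have -> : cos c * y - y = (cos c - 1) * y by ring.
have cr : `|c| <= r by rewrite ger0_norm//; move: yr; rewrite ger0_norm//; lra.
have := cos_quadratic cr; rewrite normrM.
have := normr_ge0 (cos c - 1); have := normr_ge0 y; nra.
Qed.

(** The real and the imaginary part each split into two errors of at most 2r^2; the constant 10
    leaves some room above their sum. *)
Lemma cexp_quadratic z : normc z <= 2^-1 ->
  normc (cexp z - 1 - z) <= 10 * normc z ^+ 2.
Proof.
move=> z2; have xr := normc_Re z; have yr := normc_Im z.
have E1 := expR_quadratic xr z2.
have C1 := cos_quadratic yr; have S1 := sin_quadratic yr z2.
apply: le_trans (normc_leD _) _.
move: (normc z : R) (normc_ge0 z) z2 xr yr E1 C1 S1 => r r0 z2.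
case: z => x y /= xr yr E1 C1 S1.
rewrite !mul0r subr0 addr0 !(oppr0, addr0, subr0).
have ex : 0 <= expR x <= 2.
  rewrite expR_ge0 /=; move: xr E1; rewrite !ler_norml => /andP[? ?] /andP[? ?].
  by nra.
case/andP: ex => ex0 ex2.
have -> : expR x * cos y - 1 - x = (expR x - 1 - x) + expR x * (cos y - 1) by ring.
have -> : expR x * sin y - y = expR x * (sin y - y) + (expR x - 1) * y by ring.
have T1 := ler_normD (expR x - 1 - x) (expR x * (cos y - 1)).
have T2 := ler_normD (expR x * (sin y - y)) ((expR x - 1) * y).
rewrite !normrM ger0_norm// in T1 T2.
have P1 : expR x * `|cos y - 1| <= 2 * r ^+ 2 by rewrite ler_pM.
have P2 : expR x * `|sin y - y| <= 2 * r ^+ 2 by rewrite ler_pM.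
have e1 : `|expR x - 1| <= 2 * r.
  move: xr E1; rewrite !ler_norml => /andP[? ?] /andP[? ?].
  have rr : r ^+ 2 <= r / 2 by rewrite expr2 ler_wpM2l.
  by apply/andP; split; lra.
have P3 : `|expR x - 1| * `|y| <= 2 * r * r by rewrite ler_pM// mulr_ge0.
apply: le_trans (lerD T1 T2) _.
apply: le_trans (lerD (lerD E1 P1) (lerD P2 P3)) _.
by have := sqr_ge0 r; rewrite expr2; lra.
Qed.

Lemma cexp_sub1 z : normc z <= 2^-1 -> normc (cexp z - 1) <= 6 * normc z.
Proof.
move=> z2; have := cexp_quadratic z2; have := normcB_ge (cexp z - 1) z.
have := normc_ge0 z; rewrite expr2; nra.
Qed.

(** Write e^z = (e^(z/n))^n and factor the difference of n-th powers: one factor is at most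
    10(B/n)^2, the other a sum of n terms at most e^B, so the error is at most C/n uniformly on the
    disc. *)
Lemma cexp_approx (B e : R) : 0 < e -> exists2 n0, (0 < n0)%N & forall n, (n0 <= n)%N ->
  forall z, normc z <= B -> normc (cexp z - (1 + z / n%:R) ^+ n) <= e.
Proof.
move=> e0; set C := 10 * B ^+ 2 * expR `|B|.
(* The summand C/e makes the error C/n at most [e]; 2|B| keeps z/n in the disc of radius 1/2. The
   sign of [B] is known only once some z is given, hence the absolute values. *)
exists (Num.truncn (C / e + 2 * `|B|)).+1 => // n nn z zB.
have B0 : 0 <= B := le_trans (normc_ge0 z) zB.
rewrite ger0_norm// in C nn *.
have n_gt : C / e + 2 * B < n%:R.
  by apply: lt_le_trans (truncnS_gt _) _; rewrite ler_nat.
have Ce : 0 <= C / e by rewrite divr_ge0 ?(ltW e0)// !mulr_ge0 ?expR_ge0 ?exprn_ge0.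
have n0 : 0 < n%:R :> R by lra.
have nz : n%:R != 0 :> R[i] by rewrite pnatr_eq0 -lt0n -(ltr_nat R).
have zn : normc (z / n%:R) <= B / n%:R.
  by rewrite normcM normcV normc_nat ler_pM2r ?invr_gt0.
have Bn : B / n%:R <= 2^-1 by rewrite ler_pdivrMr//; lra.
set s := z / n%:R in zn *.
have -> : cexp z = cexp s ^+ n by rewrite -cexpX -mulr_natr divfK.
rewrite subrXX normcM.
have A0 : 0 <= expR (B / n%:R) by exact: expR_ge0.
have a1 : normc (cexp s) <= expR (B / n%:R).
  by apply: le_trans (normc_cexp_le _) _; rewrite ler_expR.
have b1 : normc (1 + s) <= expR (B / n%:R).
  apply: le_trans (normcD _ _) _; rewrite normc1.
  by apply: le_trans (expR_ge1Dx _); rewrite lerD2l.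
have S1 : normc (\sum_(i < n) cexp s ^+ (n.-1 - i) * (1 + s) ^+ i) <= n%:R * expR B.
  apply: le_trans (normc_sum _ _ _) _.
  apply: (@le_trans _ _ (\sum_(i < n) expR B)); last first.
    by rewrite sumr_const card_ord -[expR B *+ n]mulr_natl.
  apply: ler_sum => i _; rewrite normcM !normcX.
  apply: (@le_trans _ _ (expR (B / n%:R) ^+ (n.-1 - i) * expR (B / n%:R) ^+ i)).
    by apply: ler_pM; rewrite ?exprn_ge0 ?normc_ge0// lerXn2r ?nnegrE ?normc_ge0.
  rewrite -exprD subnK; last by rewrite -ltnS (ltn_predK (ltn_ord i)).
  rewrite -expRM_natr ler_expR -mulrA ler_piMr// mulrC ler_pdivrMr// mul1r ler_nat.
  exact: leq_pred.
have D1 : normc (cexp s - (1 + s)) <= 10 * (B / n%:R) ^+ 2.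
  rewrite opprD addrA; apply: le_trans (cexp_quadratic (le_trans zn Bn)) _.
  by rewrite ler_pM2l// lerXn2r ?nnegrE ?normc_ge0 ?divr_ge0 ?ler0n.
apply: le_trans (ler_pM (normc_ge0 _) (normc_ge0 _) D1 S1) _.
have -> : 10 * (B / n%:R) ^+ 2 * (n%:R * expR B) = C / n%:R.
  by rewrite /C; field; rewrite gt_eqF.
rewrite ler_pdivrMr// mulrC -ler_pdivrMr//; lra.
Qed.

Lemma sin_atan y : sin (atan y) = y * cos (atan y).
Proof.
have c0 : cos (atan y) != 0.
  by rewrite cos_atan invr_eq0 gt_eqF// sqrtr_gt0 ltr_pwDl ?sqr_ge0.
by rewrite -{2}(atanK y) /tan divfK.
Qed.

(** A local logarithm in the right half-plane: v = ln|u| + i atan(Im u/Re u), small near u = 1 by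
    continuity of ln at 1 and of atan at 0. *)
Lemma clog_small (d : R) : 0 < d -> exists2 e : R, 0 < e &
  forall u, normc (u - 1) < e -> exists2 v, cexp v = u & normc v < d.
Proof.
move=> d0.
have d2 : 0 < d / 2 by rewrite divr_gt0.
have [e1 e10 H1] : exists2 e : R, 0 < e & forall x, `|x - 1| < e -> `|ln x| < d / 2.
  have /cvgrPdist_lt/(_ _ d2) := @continuous_ln R 1 ltr01.
  rewrite ln1 => /nbhs_ballP[e /= e0 He]; exists e => // x xe.
  have := He x; rewrite /ball/= distrC => /(_ xe); by rewrite sub0r normrN.
have [e2 e20 H2] : exists2 e : R, 0 < e & forall x, `|x| < e -> `|atan x| < d / 2.
  have /cvgrPdist_lt/(_ _ d2) := @continuous_atan R 0.
  rewrite atan0 => /nbhs_ballP[e /= e0 He]; exists e => // x xe.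
  have := He x; rewrite /ball/= sub0r normrN => /(_ xe); by rewrite sub0r normrN.
(* The bound 1/2 forces Re u > 1/2, hence |Im u/Re u| < 2|Im u|, which explains e2/2. *)
exists (Num.min (Num.min (2^-1) e1) (e2 / 2)) => [|u].
  by rewrite !lt_min e10 invr_gt0 ltr0n divr_gt0.
rewrite !lt_min => /andP[/andP[u2 ue1] ue2].
have nu : `|normc u - 1| <= normc (u - 1).
  have := normcB_ge u 1; have := normcB_ge 1 u; rewrite normc1 (normcBC 1) ler_norml.
  by lra.
have ux : `|complex.Re u - 1| <= normc (u - 1).
  by have := normc_Re (u - 1); rewrite ReD ReN.
have uy : `|complex.Im u| <= normc (u - 1).
  by have := normc_Im (u - 1); rewrite ImD ImN /= subr0.
have x0 : 2^-1 < complex.Re u by move: ux; rewrite ler_norml; lra.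
have u0 : 0 < normc u by move: nu; rewrite ler_norml; lra.
exists (ln (normc u) +i* atan (complex.Im u / complex.Re u)); last first.
  apply: le_lt_trans (normc_leD _) _ => /=.
  have -> : d = d / 2 + d / 2 by field.
  apply: ltrD; [apply: H1|apply: H2]; first exact: le_lt_trans nu _.
  rewrite normrM normfV [`|complex.Re u|]gtr0_norm ?ltr_pdivrMr; nra.
rewrite /cexp /= lnK ?posrE// sin_atan cos_atan.
case: u x0 u0 {u2 ue1 ue2 nu ux uy} => x y /= x0 u0.
have x0' : 0 < x by lra.
set s := Num.sqrt (x ^+ 2 + y ^+ 2) in u0 *.
have -> : Num.sqrt (1 + (y / x) ^+ 2) = s / x.
  have -> : 1 + (y / x) ^+ 2 = (x ^+ 2 + y ^+ 2) * (x^-1) ^+ 2 by field; rewrite gt_eqF.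
  by rewrite sqrtrM ?addr_ge0 ?sqr_ge0// sqrtr_sqr ger0_norm// invr_ge0 ltW.
by simpc; congr (_ +i* _); field; rewrite !gt_eqF.
Qed.

End ComplexExp.

(** * Residues of quotients of exponentials *)

Section RootsOfUnity.

(** Lagrange interpolation of the constant 1 at the points of [s]: the interpolant [p] has degree
    below the number of points, so it is 1 everywhere, and dividing its value at [u] by the full
    product gives the partial fractions. *)
Lemma prod_sub_inv (F : fieldType) (s : seq F) (u : F) :
  uniq s -> s != [::] -> u \notin s ->
  (\prod_(x <- s) (u - x))^-1 =
  \sum_(x <- s) (u - x)^-1 * (\prod_(y <- s | y != x) (x - y))^-1.
Proof.
move=> us s0 uns.
pose p : {poly F} := \sum_(x <- s)
  (\prod_(y <- s | y != x) (x - y))^-1 *: \prod_(y <- s | y != x) ('X - y%:P).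
have px x v : (\prod_(y <- s | y != x) ('X - y%:P)).[v] = \prod_(y <- s | y != x) (v - y).
  by rewrite horner_prod; apply: eq_bigr => y _; rewrite hornerXsubC.
have p1 : p = 1.
  apply/eqP; rewrite -subr_eq0; apply/eqP/(roots_geq_poly_eq0 (rs := s)) => //.
    apply/allP => x xs; rewrite rootE hornerD hornerN hornerC subr_eq0.
    rewrite horner_sum (bigD1_seq x)//= [X in _ + X]big1_seq ?addr0 => [|y /andP[yx ys]].
      rewrite hornerZ px mulVf// prodf_seq_neq0.
      by apply/allP => y ys; apply/implyP => yx; rewrite subr_eq0 eq_sym.
    rewrite hornerZ px (_ : \prod_(_ <- s | _) _ = 0) ?mulr0//.
    by apply/eqP; rewrite prodf_seq_eq0; apply/hasP; exists x; rewrite // eq_sym yx subrr eqxx.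
  apply: leq_trans (size_polyD _ _) _; rewrite geq_max size_polyN size_poly1.
  rewrite lt0n size_eq0 s0 andbT.
  apply: leq_trans (size_sum _ _ _) _; apply/bigmax_leqP_seq => x xs _.
  apply: leq_trans (size_scale_leq _ _) _.
  rewrite -big_filter size_prod_XsubC size_filter -(count_predC (pred1 x) s).
  by rewrite -addn1 addnC leq_add// -has_count has_pred1.
have := congr1 (fun p => p.[u]) p1; rewrite hornerC horner_sum => E.
rewrite -[LHS]mulr1 -[X in _ * X = _]E mulr_sumr; apply: eq_big_seq => x xs.
have B0 : \prod_(y <- s | y != x) (u - y) != 0.
  rewrite prodf_seq_neq0; apply/allP => y ys; apply/implyP => _; rewrite subr_eq0.
  by apply: contraNneq uns => ->.
have ux : u - x != 0 by rewrite subr_eq0; apply: contraNneq uns => ->.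
have -> : \prod_(y <- s) (u - y) = (u - x) * \prod_(y <- s | y != x) (u - y).
  by rewrite (bigD1_seq x).
rewrite hornerZ px invfM -mulrA; congr (_ * _).
by rewrite mulrCA mulVf ?mulr1.
Qed.

(** The last product is 1 + X + ... + X^(n-1) at X = 1. Its inverse is the partial fraction
    coefficient at the root 1. *)
Lemma unity_roots (F : closedFieldType) n : n%:R != 0 :> F -> exists s : seq F,
  [/\ uniq s, 1 \in s, {in s, forall z, z ^+ n = 1},
      forall u, u ^+ n - 1 = \prod_(x <- s) (u - x)
    & \prod_(y <- s | y != 1) (1 - y) = n%:R].
Proof.
move=> n0; have ngt0 : (0 < n)%N by case: n n0; rewrite ?eqxx.
have [s] := closed_field_poly_normal ('X^n - 1 : {poly F}).
rewrite (monicP (monicXnsubC 1 ngt0)) scale1r => sE.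
have us : uniq s.
  by rewrite -separable_prod_XsubC -sE; exact: separable_Xn_sub_1.
have ev u : u ^+ n - 1 = \prod_(x <- s) (u - x).
  have := congr1 (fun p => p.[u]) sE; rewrite hornerD hornerN hornerXn hornerC => ->.
  by rewrite horner_prod; apply: eq_bigr => y _; rewrite hornerXsubC.
have sroot z : (z \in s) = (z ^+ n == 1).
  by rewrite -root_prod_XsubC -sE rootE hornerD hornerN hornerXn hornerC subr_eq0.
have s1 : 1 \in s by rewrite sroot expr1n.
exists s; split=> //; first by move=> z; rewrite sroot => /eqP.
have : \prod_(y <- s | y != 1) ('X - y%:P) = \sum_(i < n) 'X^i :> {poly F}.
  apply: (mulfI (negbT (polyXsubC_eq0 1))).
  by rewrite -[LHS](bigD1_seq 1)//= -sE -subrX1.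
move=> /(congr1 (fun p => p.[1])); rewrite horner_prod horner_sum.
under eq_bigr do rewrite hornerXsubC.
move=> ->; under eq_bigr do rewrite hornerXn expr1n.
by rewrite sumr_const card_ord.
Qed.

(** For z different from 1 the powers of z sum to 0, so n is the sum of the 1 - z^i, each of modulus
    at most n|z - 1|; hence n|z - 1| >= 1. *)
Lemma unity_root_near1 (R : rcfType) (z : R[i]) n : (0 < n)%N -> z ^+ n = 1 ->
  n%:R * normc (z - 1) < 1 -> z = 1.
Proof.
move=> n0 zn zn1; have z1 : normc z = 1.
  by apply/eqP; rewrite -(pexpr_eq1 n0) ?normc_ge0// -normcX zn normc1.
apply/eqP; rewrite -subr_eq0; apply: contraTT zn1 => z0.
have S0 : \sum_(i < n) z ^+ i = 0.
  by apply: (mulfI z0); rewrite -subrX1 zn subrr mulr0.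
have : normc (\sum_(i < n) (1 - z ^+ i)) = n%:R.
  by rewrite sumrB S0 subr0 sumr_const card_ord normc_nat.
have B (i : 'I_n) : normc (1 - z ^+ i) <= n%:R * normc (z - 1).
  rewrite normcBC subrX1 normcM mulrC ler_wpM2r ?normc_ge0//.
  apply: le_trans (normc_sum _ _ _) _.
  under eq_bigr do rewrite normcX z1 expr1n.
  by rewrite sumr_const card_ord ler_nat ltnW.
move=> E; rewrite -leNgt -(ler_pM2l (_ : 0 < n%:R)) ?ltr0n// mulr1 -{1}E.
apply: le_trans (normc_sum _ _ _) _.
apply: le_trans (ler_sum _ (fun i _ => B i)) _.
by rewrite sumr_const card_ord -[_ *+ n]mulr_natl.
Qed.

End RootsOfUnity.

(** * Residues for an exponential over z - r and over e^(L(z-p)) - 1 *)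

Section ContourExp.
Variables (R : realType) (g : R -> R[i]) (a b : R).
Hypothesis gC : closed_contour g a b.
Implicit Types (c r w L M p : R[i]).

Definition cauchy_kernel r := cint g a b (fun t => (g t - r)^-1).

(** The difference quotient of the exponential at [r] integrates to 0, as a uniform limit along the
    contour of the quotients (P(z) - P(r))/(z - r), which are polynomials when P is one. *)
Lemma cint_exp_kernel M r : {in `[a, b], forall t, g t != r} ->
  cint g a b (fun t => cexp (M * g t) / (g t - r)) = cexp (M * r) * cauchy_kernel r.
Proof.
move=> gr; have cg := contour_ccont gC; have ab := closed_contour_le gC.
have cV := ccont_inv_sub gC gr.
have cE : ccont a b (fun t => cexp (M * g t)).
  by apply: ccont_cexp; apply: ccontM => //; exact: ccont_cst.
have cD : ccont a b (fun t => (cexp (M * g t) - cexp (M * r)) / (g t - r)).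
  by apply: ccontM => //; apply: ccontB => //; exact: ccont_cst.
suff E0 : cint g a b (fun t => (cexp (M * g t) - cexp (M * r)) / (g t - r)) = 0.
  rewrite -(cintZ gC)// -[RHS]add0r -{1}E0 -(cintD gC)//; last first.
    by apply: ccontM => //; exact: ccont_cst.
  by apply: eq_cint => t _; rewrite mulrBl subrK.
apply: (cint_closed gC) => // e e0.
have [G G0 gG] := ccont_bounded ab cg.
have [K K0 VK] := ccont_bounded ab cV.
(* Two approximation errors occur, at [g t] and at [r], and each is multiplied by the bound [K] of
   the kernel. *)
have eK : 0 < e / (2 * K) by rewrite divr_gt0// mulr_gt0.
have [n0 n00 Hn] := cexp_approx (normc M * (G + normc r)) eK.
pose P : {poly R[i]} := (1 + (M / n0%:R) *: 'X) ^+ n0.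
have Pe z : P.[z] = (1 + M * z / n0%:R) ^+ n0.
  by rewrite /P horner_exp hornerD hornerC hornerZ hornerX mulrAC.
have Pz z : normc z <= G + normc r -> normc (cexp (M * z) - P.[z]) <= e / (2 * K).
  move=> zG; rewrite Pe; apply: Hn => //.
  by rewrite normcM ler_wpM2l ?normc_ge0.
have /factor_theorem[S SE] : root (P - P.[r]%:P) r.
  by rewrite rootE hornerD hornerN hornerC subrr.
have Sz z : P.[z] - P.[r] = S.[z] * (z - r).
  by have := congr1 (fun q : {poly R[i]} => q.[z]) SE;
    rewrite hornerD hornerN hornerC hornerM hornerXsubC.
exists (fun t => S.[g t]); split; first exact: ccont_horner.
- exact: cint_polynomial.
move=> t tab; have gr0 : g t - r != 0 by rewrite subr_eq0 gr.
have -> : S.[g t] = (P.[g t] - P.[r]) / (g t - r) by rewrite Sz mulfK.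
rewrite -mulrBl normcM.
rewrite (_ : _ - _ = (cexp (M * g t) - P.[g t]) - (cexp (M * r) - P.[r])); last by ring.
have H1 := Pz (g t) (ler_wpDr (normc_ge0 r) (gG t tab)).
have H2 := Pz r (ler_wpDl (ltW G0) (lexx _)).
have H3 := normcD (cexp (M * g t) - P.[g t]) (- (cexp (M * r) - P.[r])).
rewrite normcNE in H3.
have -> : e = (e / (2 * K) + e / (2 * K)) * K by field; rewrite gt_eqF.
apply: ler_pM; rewrite ?normc_ge0 ?VK//.
exact: le_trans H3 (lerD H1 H2).
Qed.

Lemma cint_exp_pole M L p : L != 0 ->
  {in `[a, b], forall t, cexp (L * (g t - p)) != 1} ->
  (forall w, cexp (L * (w - p)) = 1 -> w != p -> cauchy_kernel w = 0) ->
  cint g a b (fun t => cexp (M * g t) / (cexp (L * (g t - p)) - 1)) =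
  cexp (M * p) * cauchy_kernel p / L.
Proof.
move=> L0 T1 W0; have cg := contour_ccont gC; have ab := closed_contour_le gC.
have nL0 : 0 < normc L by rewrite normc_gt0.
have cT : ccont a b (fun t => cexp (L * (g t - p)) - 1).
  apply: ccontB; last exact: ccont_cst.
  apply: ccont_cexp; apply: ccontM; first exact: ccont_cst.
  by apply: ccontB => //; exact: ccont_cst.
have T0 : {in `[a, b], forall t, cexp (L * (g t - p)) - 1 != 0}.
  by move=> t /T1; rewrite subr_eq0.
have cE : ccont a b (fun t => cexp (M * g t)).
  by apply: ccont_cexp; apply: ccontM => //; exact: ccont_cst.
have [m m0 Tm] := ccont_lower_bound ab cT T0.
have [G G0 gG] := ccont_bounded ab cg.
have [K K0 EK] := ccont_bounded ab cE.
(* For |v| <= 1/2 one has |e^v - 1| <= 6|v|, so |v| <= m/12 gives at most m/2 < m. Hence the contour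
   keeps distance d0/|L| from every zero of e^(L(w-p)) - 1. *)
pose d0 : R := Num.min 2^-1 (m / 12).
have d00 : 0 < d0 by rewrite lt_min invr_gt0 ltr0n divr_gt0.
pose d := d0 / normc L; have dgt0 : 0 < d by rewrite divr_gt0.
have far w : cexp (L * (w - p)) = 1 -> {in `[a, b], forall t, d <= normc (g t - w)}.
  move=> Tw t tab; rewrite leNgt; apply/negP => gw.
  have Lgw : normc (L * (g t - w)) <= d0.
    by rewrite normcM mulrC -ler_pdivlMr// ltW.
  have := Tm t tab; rewrite (_ : L * (g t - p) = L * (g t - w) + L * (w - p)); last by ring.
  rewrite cexpD Tw mulr1; move: Lgw; rewrite le_min => /andP[/cexp_sub1 h1 h2].
  by lra.
(* This makes |v/L| <= d/2, as local constancy requires, and also |v| < 1, which excludes w = p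
   below. *)
pose del := d0 / 2; have del0 : 0 < del by rewrite divr_gt0.
have [e1 e10 Hlog] := clog_small del0.
pose B := normc L * (2 * G + normc p).
apply: (cint_closed gC) => [|e e0].
  by apply: ccontM => //; exact: ccontV.
(* The three bounds serve, in order, the logarithm near 1, the estimate |Q| >= m/2 on the contour,
   and the final error K eta/(m (m/2)) <= e. *)
pose eta := Num.min (e1 / 2) (Num.min (m / 2) (e * m ^+ 2 / (2 * K))).
have eta0 : 0 < eta.
  by rewrite !lt_min !divr_gt0 ?mulr_gt0 ?exprn_gt0.
have [n n0 /(_ n (leqnn n)) Hn] := cexp_approx B eta0.
have nC0 : n%:R != 0 :> R[i] by rewrite pnatr_eq0 -lt0n.
have [s [us s1 sn sprod sder]] := unity_roots nC0.
(* The solution w of 1 + L(w - p)/n = z; the root z = 1 gives [p] itself. *)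
pose pole z := p + n%:R * (z - 1) / L.
have poleE z : 1 + L * (pole z - p) / n%:R = z by rewrite /pole; field; rewrite L0 nC0.
have poleW z : z \in s -> z != 1 -> cauchy_kernel (pole z) = 0.
  move=> zs z1; have [fz|nz] := leP (2 * G) (normc (pole z)).
    by have [_] := cint_inv_far gC G0 gG fz.
  have wB : normc (L * (pole z - p)) <= B.
    rewrite normcM ler_wpM2l ?normc_ge0//; apply: le_trans (normcD _ _) _.
    by rewrite normcNE lerD2r ltW.
  have := Hn _ wB; rewrite poleE sn// !le_min => /andP[uz _].
  have [|v vE vd] := Hlog (cexp (L * (pole z - p))).
    by apply: le_lt_trans uz _; lra.
  (* [v] is a small logarithm of e^(L(pole z - p)), so this correction lands on an exact zero of
     e^(L(w-p)) - 1. *)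
  pose w := pole z - v / L.
  have Tw : cexp (L * (w - p)) = 1.
    rewrite (_ : L * (w - p) = L * (pole z - p) - v); last by rewrite /w; field.
    by rewrite cexpD cexpN vE divff// cexp_neq0.
  have pw : normc (pole z - w) <= d / 2.
    rewrite (_ : pole z - w = v / L); last by rewrite /w; ring.
    by rewrite normcM normcV ler_pdivrMr// /d mulrAC divfK ?gt_eqF// ltW.
  have [_] := cint_inv_const gC dgt0 (far w Tw) pw.
  rewrite /cauchy_kernel => ->; apply: W0 => //; apply: contra_neq z1 => wp.
  (* If w were p, then n(z - 1) = v with |v| < 1, which forces z = 1. *)
  apply: (unity_root_near1 n0) => //; first exact: sn.
  have -> : n%:R * normc (z - 1) = normc v.
    rewrite -normc_nat -normcM; congr normc.
    apply/eqP; rewrite -subr_eq0.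
    have -> : n%:R * (z - 1) - v = (w - p) * L by rewrite /w /pole; field.
    by rewrite wp subrr mul0r.
  apply: lt_le_trans vd _; rewrite /del; have : d0 <= 2^-1 by rewrite ge_min lexx.
  by lra.
pose Q t := (1 + L * (g t - p) / n%:R) ^+ n - 1.
have QT : {in `[a, b], forall t, normc (cexp (L * (g t - p)) - 1 - Q t) <= eta}.
  move=> t tab; rewrite /Q opprB addrA subrK; apply: Hn.
  rewrite normcM ler_wpM2l ?normc_ge0//; apply: le_trans (normcD _ _) _.
  by rewrite normcNE lerD2r; have := gG t tab; lra.
have Qm : {in `[a, b], forall t, m / 2 <= normc (Q t)}.
  move=> t tab; have := QT t tab; have := Tm t tab.
  have := normcB_ge (cexp (L * (g t - p)) - 1) (cexp (L * (g t - p)) - 1 - Q t).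
  rewrite subKr /eta !le_min => h1 h2 /andP[_ /andP[h3 _]].
  by lra.
have Q0 : {in `[a, b], forall t, Q t != 0}.
  by move=> t tab; rewrite -normc_gt0; apply: lt_le_trans (Qm t tab); rewrite divr_gt0.
have us_notin : {in `[a, b], forall t, 1 + L * (g t - p) / n%:R \notin s}.
  move=> t /Q0; apply: contra => /sn; rewrite /Q => ->. by rewrite subrr.
have gpole z : z \in s -> {in `[a, b], forall t, g t != pole z}.
  by move=> zs t /us_notin; apply: contra => /eqP ->; rewrite poleE.
have cQ : ccont a b Q.
  apply: ccontB; last exact: ccont_cst.
  apply: ccontX; apply: ccontD; first exact: ccont_cst.
  apply: ccontM; last exact: ccont_cst.
  apply: ccontM; first exact: ccont_cst.
  by apply: ccontB => //; exact: ccont_cst.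
exists (fun t => cexp (M * g t) / Q t); split.
- by apply: ccontM => //; exact: ccontV.
- pose A z := (\prod_(y <- s | y != z) (z - y))^-1.
  have ck z : z \in s -> ccont a b (fun t => cexp (M * g t) / (g t - pole z)).
    by move=> zs; apply: ccontM => //; apply: (ccont_inv_sub gC); exact: gpole.
  transitivity (cint g a b (fun t => \sum_(z <- s)
      (n%:R / L * A z) * (cexp (M * g t) / (g t - pole z)))).
    apply: eq_cint => t tab; rewrite /Q sprod prod_sub_inv ?us_notin//; last first.
      by case: (s) s1.
    rewrite mulr_sumr; apply: eq_big_seq => z zs.
    have gz : g t - pole z != 0 by rewrite subr_eq0 gpole.
    rewrite (_ : 1 + L * (g t - p) / n%:R - z = L / n%:R * (g t - pole z)); last first.
      by rewrite /pole; field; rewrite L0 nC0.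
    by rewrite /A; set A' := (\prod_(y <- s | _) _)^-1; field; rewrite gz L0 nC0.
  rewrite (cint_sum gC) => [|z zs]; last by apply: ccontM (ck z zs); exact: ccont_cst.
  rewrite (bigD1_seq 1)//= big1_seq ?addr0 => [|z /andP[z1 zs]]; last first.
    rewrite (cintZ gC); last exact: ck.
    by rewrite cint_exp_kernel ?poleW ?mulr0//; exact: gpole.
  rewrite (cintZ gC); last exact: ck.
  rewrite cint_exp_kernel; last exact: gpole.
  (* The coefficient at the root 1 is (n/L)(1/n) = 1/L, whatever n is. *)
  rewrite /A sder (_ : pole 1 = p); last by rewrite /pole subrr mulr0 mul0r addr0.
  by field; rewrite L0 nC0.
- move=> t tab; have T0t := T0 t tab; have Q0t := Q0 t tab.
  rewrite -mulrBr normcM.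
  have -> : (cexp (L * (g t - p)) - 1)^-1 - (Q t)^-1 =
     - (cexp (L * (g t - p)) - 1 - Q t) / ((cexp (L * (g t - p)) - 1) * Q t).
    by field; rewrite Q0t T0t.
  rewrite [normc (_ / _)]normcM normcNE normcV [normc ((_ - 1) * _)]normcM.
  have E1 := EK t tab; have Q1 := QT t tab; have M1 := Tm t tab; have M2 := Qm t tab.
  have e2 : eta <= e * m ^+ 2 / (2 * K) by rewrite !ge_min lexx !orbT.
  have D0 : 0 <= normc (cexp (L * (g t - p)) - 1) * normc (Q t).
    by rewrite mulr_ge0 ?normc_ge0.
  have -> : e = K * ((e * m ^+ 2 / (2 * K)) / (m * (m / 2))) by field; rewrite !gt_eqF.
  apply: ler_pM => //; rewrite ?normc_ge0 ?divr_ge0 ?normc_ge0//.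
  apply: ler_pM => //; rewrite ?invr_ge0 ?normc_ge0//; first exact: le_trans e2.
  rewrite lef_pV2 ?posrE ?mulr_gt0 ?divr_gt0 ?normc_gt0//.
  by apply: ler_pM => //; rewrite ltW// divr_gt0.
Qed.

End ContourExp.

(** * Partial fractions of the integrand and its integral as a sum over the nodes *)

Lemma prod_sub_inv_fin (F : fieldType) (I : finType) (c : I -> F) (u : F) :
  (0 < #|I|)%N -> injective c -> (forall i, u != c i) ->
  (\prod_i (u - c i))^-1 =
  \sum_i (u - c i)^-1 * (\prod_(k | k != i) (c i - c k))^-1.
Proof.
move=> I0 cI uc; pose s := [seq c i | i <- enum I].
have -> : \prod_i (u - c i) = \prod_(x <- s) (u - x).
  by rewrite big_map -big_enum.
rewrite prod_sub_inv; first last.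
- by apply/mapP => -[i _ /eqP]; rewrite (negPf (uc i)).
- by rewrite -size_eq0 size_map -cardE -lt0n.
- by rewrite map_inj_uniq ?enum_uniq.
rewrite big_map big_enum; apply: eq_bigr => i _; congr (_ * _^-1).
by rewrite big_map big_enum_cond; apply: eq_bigl => k; rewrite (inj_eq cI).
Qed.

(** The denominator factors as (u - v)(uv - 1)/(uv), with the two distinct roots u = v and u =
    v^-1. *)
Lemma inv_sub_reciprocal (F : fieldType) (u v : F) :
  u != 0 -> v != 0 -> u / v != 1 -> u * v != 1 -> v - v^-1 != 0 ->
  (u + u^-1 - (v + v^-1))^-1 =
  ((u / v - 1)^-1 - (u * v - 1)^-1) / (v - v^-1).
Proof.
move=> u0 v0; rewrite -(inj_eq (mulIf v0)) divfK// mul1r -subr_eq0 => uv.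
rewrite -[_ == 1]subr_eq0 => uv1 vv.
have -> : u + u^-1 - (v + v^-1) = (u - v) * (u * v - 1) / (u * v).
  by field; rewrite u0 v0.
have -> : u / v - 1 = (u - v) / v by field.
have v2 : v * v - 1 != 0.
  apply: contra_neq vv => E; rewrite -[X in X - _ = _](mulfK v0).
  by move/subr0_eq: E => ->; rewrite mul1r subrr.
have -> : v - v^-1 = (v * v - 1) / v by field.
by field; rewrite u0 v0 uv uv1 v2.
Qed.

Section ContourIntegrand.
Variables (R : realType) (N : nat) (lam : N.-tuple nat) (q Lq : R[i]).
Variables (g : R -> R[i]) (a b : R).
Hypothesis gC : closed_contour g a b.
Hypothesis gE : contour_encloses_nodes lam q Lq g a b.
Hypothesis qE : cexp Lq = q.
Hypothesis Lq0 : Lq != 0.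

Let y (i : 'I_N) : R[i] := q ^+ shifted_part lam i.
Let c (i : 'I_N) : R[i] := y i + (y i)^-1.
Let C (z : R[i]) : R[i] := cpow Lq (z + 1) + cpow Lq (- z - 1).

Hypothesis y2 : forall i, y i - (y i)^-1 != 0.
Hypothesis cI : injective c.

Lemma two_pi_i_neq0 : two_pi_i R != 0.
Proof.
by rewrite /two_pi_i eq_complex /= eqxx /= mulf_neq0// gt_eqF// pi_gt0.
Qed.

Lemma cauchy_kernelE w : cauchy_kernel g a b w = two_pi_i R * winding_number g a b w.
Proof. by rewrite /winding_number mulrA divff ?two_pi_i_neq0// mul1r. Qed.

Lemma integrand_denomE z : integrand_denom lam q Lq z = \prod_i (C z - c i).
Proof. by apply: eq_bigr => i _; rewrite /C /c /y opprD addrA addrAC. Qed.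

Lemma y_neq0 i : y i != 0.
Proof. by rewrite expf_neq0// -qE cexp_neq0. Qed.

Lemma cexp_nat n : cexp (Lq * n%:R) = q ^+ n.
Proof. by rewrite mulr_natr cexpX qE. Qed.

Lemma CE z : C z = cexp (Lq * (z + 1)) + (cexp (Lq * (z + 1)))^-1.
Proof. by rewrite /C /cpow -opprD mulNr cexpN mulrC. Qed.

Lemma nodeE i : node R lam i + 1 = (shifted_part lam i)%:R.
Proof. by rewrite natr1 -addnS subnSK. Qed.

Lemma cexp_node i z : cexp (Lq * (z - node R lam i)) = cexp (Lq * (z + 1)) / y i.
Proof.
rewrite /y -cexp_nat -cexpN -cexpD -nodeE; congr cexp; ring.
Qed.

(** The point [- node - 2] mirrors the node under z+1 -> -(z+1), which exchanges u and u^-1; it is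
    the base pole of the second fraction. *)
Lemma cexp_conode i z :
  cexp (Lq * (z - (- node R lam i - 2))) = cexp (Lq * (z + 1)) * y i.
Proof. rewrite /y -cexp_nat -cexpD -nodeE; congr cexp; ring. Qed.

Lemma C_node i : C (node R lam i) = c i.
Proof. by rewrite CE nodeE cexp_nat. Qed.

Lemma cauchy_kernel_node i : cauchy_kernel g a b (node R lam i) = two_pi_i R.
Proof. by case: gE => _ W _; rewrite cauchy_kernelE W mulr1. Qed.

(** By injectivity of [c], another node cannot share the value [c i]; so [w] is a zero of the
    denominator that is no node, and the contour does not wind around it. *)
Lemma cauchy_kernel_other i w : C w = c i -> w != node R lam i ->
  cauchy_kernel g a b w = 0.
Proof.
move=> Cw wi; case: gE => _ _ W; rewrite cauchy_kernelE W ?mulr0// => [|k].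
  by rewrite integrand_denomE (bigD1 i)//= Cw subrr mul0r.
have [->//|ki] := eqVneq k i; apply: contra_neq ki => wk.
by apply: cI; rewrite -Cw wk C_node.
Qed.

Lemma C_neq : {in `[a, b], forall t i, C (g t) != c i}.
Proof.
move=> t tab i; case: gE => /(_ t); rewrite inE/= => /(_ tab) + _ _.
by rewrite integrand_denomE; apply: contraNneq => Ci; rewrite (bigD1 i)//= Ci subrr mul0r.
Qed.

(** Of the two fractions in u, the first contributes only at the node. The second contributes
    nothing, since none of its poles, the mirror image of the node included, has nonzero winding
    number. *)
Lemma cint_residue M i :
  cint g a b (fun t => cexp (M * (g t + 1)) / (C (g t) - c i)) =
  two_pi_i R * (cexp (M * (shifted_part lam i)%:R) / (Lq * (y i - (y i)^-1))).
Proof.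
have y0 := y_neq0 i; have cg := contour_ccont gC.
have uC z : cexp (Lq * (z + 1)) = y i \/ cexp (Lq * (z + 1)) = (y i)^-1 -> C z = c i.
  by rewrite CE /c; case=> ->; rewrite ?invrK// addrC.
have H1 : {in `[a, b], forall t, cexp (Lq * (g t - node R lam i)) != 1}.
  move=> t tab; apply: contra_neq (C_neq tab i) => E; apply: uC; left.
  by move: E; rewrite cexp_node => /divr1_eq.
have H2 : {in `[a, b], forall t, cexp (Lq * (g t - (- node R lam i - 2))) != 1}.
  move=> t tab; apply: contra_neq (C_neq tab i) => E; apply: uC; right.
  by move: E; rewrite cexp_conode => E; apply: (mulIf y0); rewrite E mulVf.
(* A pole of the second fraction cannot be the node, as that would give (y i)^2 = 1, against
   [y2]. *)
have K2 w : cexp (Lq * (w - (- node R lam i - 2))) = 1 -> cauchy_kernel g a b w = 0.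
  rewrite cexp_conode => E; apply: (cauchy_kernel_other (i := i)).
    by apply: uC; right; apply: (mulIf y0); rewrite E mulVf.
  apply: contra_neq (y2 i) => wE; move: E; rewrite wE nodeE cexp_nat -/(y i) => E.
  by rewrite -[X in X - _](mulfK y0) E mul1r subrr.
have W0 : cauchy_kernel g a b (- node R lam i - 2) = 0.
  by apply: K2; rewrite subrr mulr0 cexp0.
have I1 := cint_exp_pole gC M Lq0 H1.
have I2 := cint_exp_pole gC M Lq0 H2.
have cM : ccont a b (fun t => cexp (M * g t)).
  by apply: ccont_cexp; apply: ccontM => //; exact: ccont_cst.
have cT p : {in `[a, b], forall t, cexp (Lq * (g t - p)) != 1} ->
    ccont a b (fun t => cexp (M * g t) / (cexp (Lq * (g t - p)) - 1)).
  move=> H; apply: ccontM => //; apply: ccontV; last first.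
    by move=> t /H; rewrite subr_eq0.
  apply: ccontB (ccont_cst _ _ _); apply: ccont_cexp; apply: ccontM.
    exact: ccont_cst.
  by apply: ccontB => //; exact: ccont_cst.
transitivity (cint g a b (fun t => cexp M / (y i - (y i)^-1) *
   (cexp (M * g t) / (cexp (Lq * (g t - node R lam i)) - 1) -
    cexp (M * g t) / (cexp (Lq * (g t - (- node R lam i - 2))) - 1)))).
  apply: eq_cint => t tab.
  have h1 := H1 t tab; have h2 := H2 t tab.
  rewrite cexp_node in h1 *; rewrite cexp_conode in h2 *.
  rewrite CE (inv_sub_reciprocal (cexp_neq0 _) y0 h1 h2 (y2 i)).
  by rewrite mulrDr mulr1 cexpD; ring.
rewrite (cintZ gC); last by apply: ccontB; exact: cT.
rewrite (cintB gC); [|exact: cT|exact: cT].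
rewrite I1 => [|w E]; last first.
  by apply: cauchy_kernel_other; apply: uC; left; move: E; rewrite cexp_node => /divr1_eq.
rewrite I2 => [|w /K2//]; rewrite W0 cauchy_kernel_node.
rewrite -nodeE [M * _ in RHS]mulrDr mulr1 cexpD mulr0 mul0r subr0.
by move: (y i - _) (y2 i) => D D0; field; rewrite D0 Lq0.
Qed.

Lemma contour_integrand Lx x : (0 < N)%N -> cexp Lx = x ->
  contour_integral g a b (integrand lam q Lq Lx) =
  two_pi_i R * \sum_i (x ^+ shifted_part lam i - x ^- shifted_part lam i) /
    (Lq * (y i - (y i)^-1)) / \prod_(k | k != i) (c i - c k).
Proof.
move=> N0 xE; have cg := contour_ccont gC.
have cF M i : ccont a b (fun t => cexp (M * (g t + 1)) / (C (g t) - c i)).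
  have cC : ccont a b (fun t => cexp (Lq * (g t + 1))).
    apply: ccont_cexp; apply: ccontM; first exact: ccont_cst.
    by apply: ccontD => //; exact: ccont_cst.
  apply: ccontM.
    apply: ccont_cexp; apply: ccontM; first exact: ccont_cst.
    by apply: ccontD => //; exact: ccont_cst.
  apply: ccontV; last by move=> t tab; rewrite subr_eq0 C_neq.
  apply: ccontB; last exact: ccont_cst.
  apply: ccont_eq (ccontD cC (ccontV cC _)) => [t|t _]; first by rewrite CE.
  exact: cexp_neq0.
transitivity (cint g a b (fun t => \sum_i (\prod_(k | k != i) (c i - c k))^-1 *
   (cexp (Lx * (g t + 1)) / (C (g t) - c i) - cexp (- Lx * (g t + 1)) / (C (g t) - c i)))).
  apply: (@eq_cint _ g a b (fun t => integrand lam q Lq Lx (g t))) => t tab.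
  rewrite /integrand integrand_denomE prod_sub_inv_fin ?card_ord//; last exact: C_neq.
  rewrite mulr_sumr; apply: eq_bigr => i _.
  have -> : cpow Lx (g t + 1) = cexp (Lx * (g t + 1)) by rewrite /cpow mulrC.
  have -> : cpow Lx (- g t - 1) = cexp (- Lx * (g t + 1)) by congr cexp; ring.
  by rewrite mulrA mulrC -mulrBl.
rewrite (cint_sum gC) => [|i _]; last first.
  by apply: ccontM; [exact: ccont_cst|exact: ccontB].
rewrite mulr_sumr; apply: eq_bigr => i _.
rewrite (cintZ gC); last exact: ccontB.
rewrite (cintB gC)// !cint_residue mulNr cexpN mulr_natr cexpX xE.
by rewrite -mulrBr -mulrBl mulrC [RHS]mulrA.
Qed.

End ContourIntegrand.

(** * Symplectic determinants *)

Section OddVandermonde.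
Variable F : fieldType.
Implicit Types (n : nat) (z : F).

(* The Chebyshev polynomials of the second kind, rescaled to be monic: the
   variable stands for z + z^-1. *)
Fixpoint cheb n : {poly F} :=
  if n is m.+1 then (if m is k.+1 then 'X * cheb m - cheb k else 'X) else 1.

Lemma size_lead_cheb n : size (cheb n) = n.+1 /\ lead_coef (cheb n) = 1.
Proof.
suff: (size (cheb n) = n.+1 /\ lead_coef (cheb n) = 1) /\
      (size (cheb n.+1) = n.+2 /\ lead_coef (cheb n.+1) = 1) by case.
elim: n => [|n [[s0 l0] [s1 l1]]].
  by rewrite /= size_poly1 lead_coef1 size_polyX lead_coefX.
have sX : size ('X * cheb n.+1) = n.+3.
  by rewrite mulrC size_mulX ?s1// -size_poly_gt0 s1.
have lt : (size (- cheb n) < size ('X * cheb n.+1)%R)%N by rewrite size_polyN s0 sX.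
split=> //; rewrite -[cheb n.+2]/('X * cheb n.+1 - cheb n) size_polyDl//.
by rewrite lead_coefDl// lead_coefM lead_coefX l1 mulr1.
Qed.

Lemma horner_cheb n z : z != 0 ->
  (cheb n).[z + z^-1] * (z - z^-1) = z ^+ n.+1 - z ^- n.+1.
Proof.
move=> z0.
suff: ((cheb n).[z + z^-1] * (z - z^-1) = z ^+ n.+1 - z ^- n.+1) /\
      ((cheb n.+1).[z + z^-1] * (z - z^-1) = z ^+ n.+2 - z ^- n.+2) by case.
elim: n => [|n [E0 E1]].
  by rewrite /= hornerC hornerX; split; field.
split=> //; rewrite -[cheb n.+2]/('X * cheb n.+1 - cheb n).
rewrite hornerD hornerN hornerM hornerX mulrBl -mulrA E1 E0 !exprS.
by set A := z ^+ n; field; rewrite z0 expf_neq0.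
Qed.

Definition vdm n (c : 'I_n -> F) : F :=
  \prod_(i < n) \prod_(j < n | (i < j)%N) (c j - c i).

Lemma vdm_det n (c : 'I_n -> F) :
  vdm c = \det (\matrix_(i < n, j < n) c j ^+ i).
Proof.
rewrite (_ : \matrix_(i, j) _ = Vandermonde n (\row_j c j)); last first.
  by apply/matrixP => i j; rewrite !mxE.
rewrite det_Vandermonde; apply: eq_bigr => i _; apply: eq_bigr => j _.
by rewrite !mxE.
Qed.

(** Each row is a monic polynomial of degree i in y + y^-1, times y - y^-1. So the matrix is a
    unitriangular matrix times a Vandermonde matrix times a diagonal one. *)
Lemma det_odd_powers n (y : 'I_n -> F) : (forall j, y j != 0) ->
  \det (\matrix_(i < n, j < n) (y j ^+ i.+1 - y j ^- i.+1)) =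
  (\prod_j (y j - (y j)^-1)) * vdm (fun j => y j + (y j)^-1).
Proof.
move=> y0; pose T : 'M[F]_n := \matrix_(i, k) (cheb i)`_k.
have -> : \matrix_(i < n, j < n) (y j ^+ i.+1 - y j ^- i.+1) =
    T *m (\matrix_(k, j) (y j + (y j)^-1) ^+ k) *m diag_mx (\row_j (y j - (y j)^-1)).
  apply/matrixP => i j; rewrite mul_mx_diag !mxE -horner_cheb//; congr (_ * _).
  rewrite (@horner_coef_wide _ n); last by rewrite (size_lead_cheb i).1.
  by apply: eq_bigr => k _; rewrite !mxE.
rewrite !det_mulmx det_diag -vdm_det mulrC; congr (_ * _).
  by apply: eq_bigr => j _; rewrite mxE.
rewrite det_trig.
  rewrite big1 ?mul1r// => i _; rewrite mxE.
  by have [s <-] := size_lead_cheb i; rewrite /lead_coef s.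
by apply/is_trig_mxP => i j ij; rewrite mxE nth_default// (size_lead_cheb i).1.
Qed.

Lemma vdm_recl n (c : 'I_n.+1 -> F) :
  vdm c = (\prod_k (c (lift ord0 k) - c ord0)) * vdm (fun k => c (lift ord0 k)).
Proof.
rewrite /vdm big_ord_recl; congr (_ * _).
  by rewrite big_mkcond big_ord_recl/= mul1r.
apply: eq_bigr => i _; rewrite [LHS]big_mkcond big_ord_recl/= mul1r.
by rewrite [RHS]big_mkcond; apply: eq_bigr => j _; rewrite /bump/= !add1n ltnS.
Qed.

(** Moving variable [j] to the front is a cycle of sign (-1)^j. *)
Lemma vdm_lift n (c : 'I_n.+1 -> F) (j : 'I_n.+1) :
  vdm c = (-1) ^+ j * (\prod_k (c (lift j k) - c j)) * vdm (fun k => c (lift j k)).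
Proof.
pose s := lift_perm ord0 j 1%g.
have E : vdm (fun i => c (s i)) = (-1) ^+ j * vdm c.
  rewrite !vdm_det (_ : \matrix_(i, k) c (s k) ^+ i =
    col_perm s (\matrix_(i, k) c k ^+ i)); last by apply/matrixP => i k; rewrite !mxE.
  by rewrite col_permE det_mulmx det_perm odd_permV odd_lift_perm odd_perm1 addbF
    /= signr_odd mulrC.
have := vdm_recl (fun i => c (s i)); rewrite E /= lift_perm_id.
rewrite (eq_bigr (fun k => c (lift j k) - c j)) => [|k _]; last first.
  by rewrite lift_perm_lift perm1.
rewrite (_ : (fun k => c (s (lift ord0 k))) = (fun k => c (lift j k))); last first.
  by apply/funext => k; rewrite lift_perm_lift perm1.
by rewrite -mulrA => <-; rewrite signrMK.
Qed.

End OddVandermonde.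

(** * The normalized character as a sum over the nodes *)

Section NormalizedCharacter.
Variable F : fieldType.
Implicit Types (x z q : F).

Definition recip z : F := z + z^-1.

(** Here the exponents decrease along a row, hence the sign of the order-reversing permutation. It
    stays unevaluated because it cancels in the normalized character. *)
Lemma det_symp_denominator n (X : 'I_n -> F) : (forall i, X i != 0) ->
  \det (\matrix_(i < n, j < n) (X i ^+ (n - j) - X i ^- (n - j))) =
  (-1) ^+ (perm (@rev_ord_inj n)) *
  ((\prod_j (X j - (X j)^-1)) * vdm (fun j => recip (X j))).
Proof.
move=> X0; rewrite -det_odd_powers// -[in RHS]det_tr.
rewrite (_ : \matrix_(i, j) _ = col_perm (perm (@rev_ord_inj n))
   (\matrix_(i < n, j < n) (X j ^+ i.+1 - X j ^- i.+1))^T).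
  by rewrite col_permE det_mulmx det_perm odd_permV mulrC.
by apply/matrixP => i j; rewrite !mxE permE /= subnSK.
Qed.

Lemma det_symp_principal n (l : 'I_n -> nat) q : q != 0 ->
  \det (\matrix_(i < n, j < n) ((q ^+ i.+1) ^+ l j - (q ^+ i.+1) ^- l j)) =
  (\prod_j (q ^+ l j - (q ^+ l j)^-1)) * vdm (fun j => recip (q ^+ l j)).
Proof.
move=> q0; rewrite -det_odd_powers => [|j]; last by rewrite expf_neq0.
by congr (\det _); apply/matrixP => i j; rewrite !mxE -!exprM mulnC.
Qed.

(** Without its first row the matrix has rows q, ..., q^n, so every minor is again a principal
    determinant and factors. *)
Lemma det_symp_first_row n (l : 'I_n.+1 -> nat) x q : q != 0 ->
  \det (\matrix_(i < n.+1, j < n.+1)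
     ((if i == 0%N :> nat then x else q ^+ i) ^+ l j
      - (if i == 0%N :> nat then x else q ^+ i) ^- l j)) =
  \sum_j (x ^+ l j - x ^- l j) * ((-1) ^+ j *
    ((\prod_k (q ^+ l (lift j k) - (q ^+ l (lift j k))^-1)) *
     vdm (fun k => recip (q ^+ l (lift j k))))).
Proof.
move=> q0; rewrite (expand_det_row _ ord0); apply: eq_bigr => j _.
rewrite !mxE /= /cofactor add0n; congr (_ * (_ * _)).
rewrite -(det_symp_principal (fun k => l (lift j k)) q0); congr (\det _).
by apply/matrixP => i k; rewrite !mxE.
Qed.

Lemma vdm_neq0 n (c : 'I_n -> F) : vdm c != 0 -> injective c.
Proof.
move=> c0; suff W (i j : 'I_n) : (i < j)%N -> c i <> c j.
  by move=> i j E; apply: val_inj; case: (ltngtP i j) => // /W; rewrite E.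
move=> ij E; case/negP: c0; rewrite /vdm (bigD1 i)//= (bigD1 j)//=.
by rewrite E subrr !mul0r.
Qed.

Section Nondegenerate.
Variables (n : nat) (lam : n.+1.-tuple nat) (q : F).
Hypothesis q0 : q != 0.
Hypothesis lam0 : symp_char_principal lam q != 0.

Let y (j : 'I_n.+1) := q ^+ shifted_part lam j.
Let c (j : 'I_n.+1) := recip (y j).

Lemma symp_principal_node_neq0 j : y j - (y j)^-1 != 0.
Proof.
move: lam0; rewrite /symp_char_principal /symp_char mulf_eq0 negb_or => /andP[+ _].
rewrite det_symp_principal// mulf_eq0 negb_or => /andP[/prodf_neq0 /(_ j isT)].
by [].
Qed.

Lemma symp_principal_vdm_neq0 : vdm c != 0.
Proof.
move: lam0; rewrite /symp_char_principal /symp_char mulf_eq0 negb_or => /andP[+ _].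
by rewrite det_symp_principal// mulf_eq0 negb_or => /andP[].
Qed.

Lemma symp_principal_recip_inj : injective c.
Proof. exact: vdm_neq0 symp_principal_vdm_neq0. Qed.

(** Since 0^-1 = 0, a nonzero quotient has a nonzero denominator too. *)
Lemma symp_principal_denominator_neq0 :
  (\prod_(j < n.+1) (q ^+ j.+1 - (q ^+ j.+1)^-1)) *
  vdm (fun j : 'I_n.+1 => recip (q ^+ j.+1)) != 0.
Proof.
move: lam0; rewrite /symp_char_principal /symp_char mulf_eq0 negb_or invr_eq0 => /andP[_].
rewrite det_symp_denominator => [|i]; last by rewrite expf_neq0.
by rewrite mulf_eq0 negb_or => /andP[].
Qed.

(** All factors not involving [j] cancel, and the cofactor sign is the one that extracts variable
    [j] from the Vandermonde product. *)
Lemma minor_ratio (j : 'I_n.+1) :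
  (-1) ^+ j * ((\prod_k (y (lift j k) - (y (lift j k))^-1)) * vdm (fun k => c (lift j k)))
  / ((\prod_k (y k - (y k)^-1)) * vdm c) =
  ((y j - (y j)^-1) * \prod_(k | k != j) (c k - c j))^-1.
Proof.
have yj := symp_principal_node_neq0 j; have v0 := symp_principal_vdm_neq0.
have lift_prod (f : 'I_n.+1 -> F) : \prod_(k | k != j) f k = \prod_k f (lift j k).
  rewrite (reindex_omap (lift j) (unlift j)).
    by apply: eq_bigl => k; rewrite liftK eqxx andbT eq_sym neq_lift.
  by move=> k kj; case: unliftP kj => [k' ->//|->]; rewrite eqxx.
rewrite (bigD1 j)//= !lift_prod (vdm_lift c j).
have Y0 : \prod_k (y (lift j k) - (y (lift j k))^-1) != 0.
  by apply/prodf_neq0 => k _; exact: symp_principal_node_neq0.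
have s0 : (-1) ^+ j != 0 :> F by rewrite signr_eq0.
move: v0; rewrite (vdm_lift c j) !mulf_eq0 !negb_or => /andP[/andP[_ P0] V0].
have cancel (s Y V D P : F) : s != 0 -> Y != 0 -> V != 0 -> D != 0 -> P != 0 ->
    s * (Y * V) / (D * Y * (s * P * V)) = (D * P)^-1.
  by move=> ? ? ? ? ?; field; apply/and5P.
exact: cancel.
Qed.

Lemma norm_symp_charE x : x != 0 -> x - x^-1 != 0 ->
  (forall k : 'I_n, recip (q ^+ k.+1) - recip x != 0) ->
  norm_symp_char lam x q =
  (q ^+ n.+1 - (q ^+ n.+1)^-1) * (\prod_(k < n) (recip (q ^+ n.+1) - recip (q ^+ k.+1)))
  / ((x - x^-1) * \prod_(k < n) (recip (q ^+ k.+1) - recip x)) *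
  \sum_j (x ^+ shifted_part lam j - x ^- shifted_part lam j) /
    ((y j - (y j)^-1) * \prod_(k | k != j) (c k - c j)).
Proof.
move=> x0 x1 xq; have := symp_principal_denominator_neq0.
pose V0 := vdm (fun k : 'I_n => recip (q ^+ k.+1)).
pose Q0 := \prod_(k < n) (q ^+ k.+1 - (q ^+ k.+1)^-1).
pose A := \prod_(k < n) (recip (q ^+ n.+1) - recip (q ^+ k.+1)).
(* Extracting the last variable costs (-1)^n, which is absorbed by reversing its n differences. *)
have vP : vdm (fun j : 'I_n.+1 => recip (q ^+ j.+1)) = A * V0.
  rewrite (vdm_lift _ ord_max) /V0.
  rewrite (_ : (-1) ^+ _ * _ = A).
    by congr (_ * vdm _); apply/funext => k; rewrite lift_max.
  rewrite -[X in (-1) ^+ X]card_ord -prodrN; apply: eq_bigr => k _.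
  by rewrite lift_max opprB.
have pP : \prod_(j < n.+1) (q ^+ j.+1 - (q ^+ j.+1)^-1) =
    Q0 * (q ^+ n.+1 - (q ^+ n.+1)^-1) by rewrite big_ord_recr.
have pX : \prod_(j < n.+1) ((if j == 0%N :> nat then x else q ^+ j) -
    (if j == 0%N :> nat then x else q ^+ j)^-1) = (x - x^-1) * Q0.
  by rewrite big_ord_recl.
rewrite vP pP !mulf_eq0 !negb_or => /andP[/andP[Q00 qn0] /andP[A0 V00]].
rewrite /norm_symp_char /symp_char_principal /symp_char.
rewrite det_symp_first_row// det_symp_principal//.
rewrite !det_symp_denominator; last 2 first.
- by move=> i; rewrite expf_neq0.
- by move=> i; case: ifP => // _; rewrite expf_neq0.
rewrite vP pP pX vdm_recl/= -/V0.
set B := \prod_(k < n) (recip _ - recip x).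
have B0 : B != 0 by apply/prodf_neq0 => k _; exact: xq.
set S := \sum_(j < n.+1) _; set S' := (X in _ = _ * X).
have Dy0 : (\prod_k (y k - (y k)^-1)) * vdm c != 0.
  rewrite mulf_neq0 ?symp_principal_vdm_neq0//.
  by apply/prodf_neq0 => k _; exact: symp_principal_node_neq0.
have SE : S = (\prod_k (y k - (y k)^-1)) * vdm c * S'.
  rewrite /S /S' mulr_sumr; apply: eq_bigr => j _.
  apply/esym; rewrite -minor_ratio mulrCA; congr (_ * _).
  by rewrite mulrC divfK.
rewrite SE.
have s0 : (-1) ^+ perm (@rev_ord_inj n.+1) != 0 :> F by rewrite signr_eq0.
have cancel (D T e X1 Q V q1 A' B' : F) : D != 0 -> e != 0 -> X1 != 0 -> Q != 0 ->
    V != 0 -> q1 != 0 -> A' != 0 -> B' != 0 ->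
    D * T / (e * (X1 * Q * (B' * V))) / (D / (e * (Q * q1 * (A' * V)))) =
    q1 * A' / (X1 * B') * T.
  by move=> ? ? ? ? ? ? ? ?; field; do ?[apply/andP; split].
exact: cancel.
Qed.

End Nondegenerate.
End NormalizedCharacter.

(** * Conversion of the products to q-Pochhammer symbols and q-factorials *)

Section QProducts.
Variable F : fieldType.
Implicit Types (x q : F) (n : nat).

(** Each factor is q^-m (1 - x q^m)(1 - x^-1 q^m) with m = k+1, and the exponents 1, ..., n add up
    to the binomial coefficient. *)
Lemma prod_recip_sub x q n : q != 0 -> x != 0 ->
  \prod_(k < n) (recip (q ^+ k.+1) - recip x) =
  q ^- 'C(n.+1, 2) * (qpoch (x * q) q n * qpoch (x^-1 * q) q n).
Proof.
move=> q0 x0; elim: n => [|n IH].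
  by rewrite /qpoch !big_ord0 expr0 invr1 !mul1r.
rewrite /qpoch !big_ord_recr /= -!/(qpoch _ _ _) IH [in RHS]binS bin1 exprD invfM /recip.
rewrite !exprS; move: (q ^+ n) (expf_neq0 n q0) => Q Q0.
move: (qpoch _ _ _) (qpoch _ _ _) (q ^+ _) (expf_neq0 'C(n.+1, 2) q0) => s t r r0.
by field; rewrite q0 x0 Q0 r0.
Qed.

(** Each difference is q^-(n+1) (q^(n+k+2) - 1)(q^(n-k) - 1), covering the exponents 1..n and
    n+2..2n+1. The leading factor supplies 2n+2, and the extra q^(n+1) - 1 fills the gap; it is the
    origin of [N]_q. *)
Lemma prod_recip_sub_last q n : q != 0 ->
  (q ^+ n.+1 - (q ^+ n.+1)^-1) *
  (\prod_(k < n) (recip (q ^+ n.+1) - recip (q ^+ k.+1))) * (q ^+ n.+1 - 1) =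
  q ^- (n.+1 * n.+1) * \prod_(k < n.+1 + n.+1) (q ^+ k.+1 - 1).
Proof.
move=> q0.
have -> : \prod_(k < n) (recip (q ^+ n.+1) - recip (q ^+ k.+1)) =
    q ^- (n.+1 * n) * ((\prod_(k < n) (q ^+ (n.+1 + k).+1 - 1)) *
                       \prod_(k < n) (q ^+ k.+1 - 1)).
  have -> : \prod_(k < n) (q ^+ k.+1 - 1) = \prod_(k < n) (q ^+ (n - k) - 1).
    by rewrite (reindex_inj rev_ord_inj); apply: eq_bigr => k _; rewrite /= subnSK.
  rewrite -big_split/=.
  have -> : q ^- (n.+1 * n) = \prod_(k < n) (q ^+ n.+1)^-1.
    by rewrite prodr_const card_ord exprM exprVn.
  rewrite -big_split/=.
  apply: eq_bigr => k _.
  have -> : q ^+ n.+1 = q ^+ k.+1 * q ^+ (n - k).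
    by rewrite -exprD addSn subnKC// ltnW.
  have -> : q ^+ (n.+1 + k).+1 = q ^+ k.+1 * q ^+ (n - k) * q ^+ k.+1.
    by rewrite -!exprD; congr (_ ^+ _); have := ltn_ord k; lia.
  rewrite /recip; have := expf_neq0 k.+1 q0; have := expf_neq0 (n - k) q0.
  by move: (q ^+ k.+1) (q ^+ (n - k)) => u v v0 u0; field; rewrite u0 v0.
rewrite big_split_ord/= !big_ord_recr/=.
have -> : q ^+ (n.+1 + n).+1 = q ^+ n.+1 * q ^+ n.+1 by rewrite -exprD addnS.
have -> : q ^- (n.+1 * n.+1) = q ^- (n.+1 * n) / q ^+ n.+1.
  by rewrite [X in q ^- X]mulnS addnC exprD invfM.
move: (\prod_(k < n) _) (\prod_(k < n) _) (q ^+ n.+1) (expf_neq0 n.+1 q0) => s t u u0.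
by move: (q ^- _) => v; field.
Qed.

Lemma qfact_prod q n : q - 1 != 0 ->
  (q - 1) ^+ n * qfact q n = \prod_(k < n) (q ^+ k.+1 - 1).
Proof.
move=> q1; rewrite /qfact big_add1 big_mkord.
have -> : (q - 1) ^+ n = \prod_(k < n) (q - 1) by rewrite prodr_const card_ord.
rewrite -big_split /=; by apply: eq_bigr => k _; rewrite /qnum mulrC divfK.
Qed.

End QProducts.

Lemma qpoch_factor_neq0 (F : fieldType) (w q : F) n (k : 'I_n) :
  qpoch (w * q) q n != 0 -> 1 - w * q ^+ k.+1 != 0.
Proof. by rewrite exprS mulrA => /prodf_neq0 /(_ k isT). Qed.

(* [Lq] and [Lx] are arbitrary choices of ln q and ln x; they determine the
   powers of q and x in the integrand.  [symp_char_principal lam q != 0] and the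
   three conditions on x say that both sides are well defined.

   The factor q^(-N(N+1)/2) is a correction: the printed formula omits it
   and is then false.  For N = 1, lambda = 0 the left side is 1, while
   the right side without this factor is (q^2 - 1) / (q - q^-1) = q. *)
Theorem theorem3p15 (R : realType) (N : nat) (lam : N.-tuple nat)
    (q Lq x Lx : R[i]) (g : R -> R[i]) (a b : R) :
  (0 < N)%N ->
  sorted geq lam ->
  q != 1 ->
  cexp Lq = q ->
  cexp Lx = x ->
  symp_char_principal lam q != 0 ->
  qpoch (x * q) q N.-1 != 0 ->
  qpoch (x^-1 * q) q N.-1 != 0 ->
  x - x^-1 != 0 ->
  closed_contour g a b ->
  contour_encloses_nodes lam q Lq g a b ->
  norm_symp_char lam x q =
    q ^- 'C(N.+1, 2) *
    ((-1) ^+ N.-1 * Lq * (q - 1) ^+ (2 * N).-1 * qfact q (2 * N)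
       / (qpoch (x * q) q N.-1 * qpoch (x^-1 * q) q N.-1
          * (x - x^-1) * qnum q N)
       * ((two_pi_i R)^-1
          * contour_integral g a b (integrand lam q Lq Lx))).
Proof.
case: N lam => // n lam _ _ q1 qE xE lam0 P1 P2 xx gC gE.
have q0 : q != 0 by rewrite -qE cexp_neq0.
have x0 : x != 0 by rewrite -xE cexp_neq0.
have Lq0 : Lq != 0 by apply: contra_neq q1 => L0; rewrite -qE L0 cexp0.
have y2 := symp_principal_node_neq0 q0 lam0.
have cI := symp_principal_recip_inj q0 lam0.
rewrite (contour_integrand gC gE qE Lq0 y2 cI _ xE)//.
rewrite [(two_pi_i R)^-1 * _]mulKf ?two_pi_i_neq0//.
have kx (k : 'I_n) : recip (q ^+ k.+1) - recip x != 0.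
  have -> : recip (q ^+ k.+1) - recip x =
      (1 - x * q ^+ k.+1) * (1 - x^-1 * q ^+ k.+1) / q ^+ k.+1.
    by rewrite /recip; have := expf_neq0 k.+1 q0; move: (q ^+ _) => u u0; field; rewrite x0 u0.
  by rewrite !mulf_neq0 ?invr_eq0 ?expf_neq0 ?qpoch_factor_neq0.
rewrite (norm_symp_charE q0 lam0 x0 xx kx) prod_recip_sub//=.
set S := (X in _ * X = _); set S' := (X in _ = _ * (_ * X)).
(* The sign reverses the n differences of each product, and [Lq] cancels the 1/[Lq] of every
   residue. *)
have SE : S = (-1) ^+ n * Lq * S'.
  rewrite /S /S' mulr_sumr; apply: eq_bigr => j _.
  have B0 : \prod_(k | k != j) (recip (q ^+ shifted_part lam j)
      - recip (q ^+ shifted_part lam k)) != 0.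
    by apply/prodf_neq0 => k kj; rewrite subr_eq0 (inj_eq cI) eq_sym.
  have -> : \prod_(k | k != j) (recip (q ^+ shifted_part lam k)
      - recip (q ^+ shifted_part lam j)) = (-1) ^+ n * \prod_(k | k != j)
      (recip (q ^+ shifted_part lam j) - recip (q ^+ shifted_part lam k)).
    have nE : #|[pred k : 'I_n.+1 | k != j]| = n by rewrite (cardC1 j) card_ord.
    by rewrite -[X in (-1) ^+ X]nE -prodrN; apply: eq_bigr => k _; rewrite opprB.
  move: B0; rewrite /recip; move: (\prod_(k | _) _) (_ - _) (y2 j) => B D D0 B0.
  have -> : D * ((-1) ^+ n * B) = (-1) ^+ n * (D * B) by rewrite mulrCA.
  rewrite invfM invr_sign; move: (x ^+ _ - _) ((-1) ^+ n) => u e.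
  by field; rewrite Lq0 D0 B0.
have q10 : q - 1 != 0 by rewrite subr_eq0.
have qN : q ^+ n.+1 - 1 != 0.
  have := symp_principal_denominator_neq0 q0 lam0; rewrite mulf_eq0 negb_or => /andP[+ _].
  move=> /prodf_neq0 /(_ ord_max isT) /=; apply: contra_neq => /subr0_eq ->.
  by rewrite invr1 subrr.
have G := qfact_prod (n.+1 + n.+1) q10.
have H := prod_recip_sub_last n q0.
rewrite -G in H; rewrite SE mul2n -addnn.
have -> : (n + 1 * n.+1)%coq_nat = (n + n.+1)%N by rewrite mul1n.
move/(canRL (mulfK qN)): H => ->.
(* With N = n+1, N^2 is the sum of the binomials C(N+1,2) and C(N,2). The second power cancels the
   one from the q-Pochhammer symbols; the first remains as the correcting factor. *)
have -> : q ^+ (n.+1 * n.+1) = q ^+ 'C(n.+2, 2) * q ^+ 'C(n.+1, 2).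
  rewrite -exprD; congr (_ ^+ _); rewrite [in RHS]binS bin1.
  by have := mul_bin_diag n.+1 1; rewrite bin1 /=; move: 'C(_, _); lia.
(* One factor q - 1 of (q - 1)^(2N) goes into [N]_q, which leaves the exponent 2N - 1. *)
rewrite addSn exprS /qnum.
have cancel (r1 r2 q' t f Q X p1 p2 e L T : R[i]) : r1 != 0 -> r2 != 0 -> q' != 0 ->
    Q != 0 -> X != 0 -> p1 != 0 -> p2 != 0 ->
    (r1 * r2)^-1 * (q' * t * f) / Q / (X * (r2^-1 * (p1 * p2))) * (e * L * T) =
    r1^-1 * (e * L * t * f / (p1 * p2 * X * (Q / q')) * T).
  by move=> ? ? ? ? ? ? ?; field; do ?[apply/andP; split].
by apply: cancel; rewrite ?expf_neq0.
Qed.
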